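(* Let $\mathbf i=(i_1,i_2,\dots)\in\mathbb{N}^{\mathbb{N}}$ and let $\mu_{\mathbf i}$ be the corresponding infinite mutation sequence on $\mathbf{LF}$. Let $S_\infty\subseteq\mathbb{N}$ be the set of values appearing infinitely many times in $\mathbf i$. Exactly one of the following occurs: (i) $\mathcal C_{\mathbf{LF}}(\mu_{\mathbf i})=\mathbf{LF}$ (so $\mathcal D_{\mathbf{LF}}(\mu_{\mathbf i})=\varnothing$); this occurs precisely when $S_\infty=\varnothing$ and the reduction $\overline\mu_{\mathbf i}$ is finite. (ii) $\mathcal C_{\mathbf{LF}}(\mu_{\mathbf i})$ and $\mathcal D_{\mathbf{LF}}(\mu_{\mathbf i})$ are both dense in $\mathbf{LF}$; this occurs precisely when $S_\infty=\varnothing$ and $\overline\mu_{\mathbf i}$ is infinite. (iii) $\mathcal C_{\mathbf{LF}}(\mu_{\mathbf i})$ is not dense in $\mathbf{LF}$; this occurs precisely when $S_\infty\neq\varnothing$. In this case, $\mathcal D_{\mathbf{LF}}(\mu_{\mathbf i})$ is dense in $\mathbf{LF}$ if and only if $S_\infty$ is infinite or $\overline\mu_{\mathbf i_{\mathbb{N}\setminus S_\infty}}$ is infinite (or both).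
   Context: $\mathbb{N}$ is the positive integers. A quiver on $\mathbb{N}$ is a function $Q:\mathbb{N}\times\mathbb{N}\to\mathbb{Z}$ with $Q(x,y)=-Q(y,x)$; it is locally finite if $\sum_y|Q(x,y)|<\infty$ for each $x$. For $V\subseteq\mathbb{N}$, the overfill $\lambda_V(Q)(x,y)=Q(x,y)$ if $x\in V$ or $y\in V$, else $0$. $\mathbf{LF}$ is the set of locally finite quivers on $\mathbb{N}$ with the topology generated by the basic sets $\{Q'\in\mathbf{LF}:\lambda_V(Q')=\lambda_V(Q)\}$, $V\subseteq\mathbb{N}$ finite. Mutation at $x$: $\mu_x(Q)(v,w)=-Q(v,w)$ if $x\in\{v,w\}$, otherwise $\mu_x(Q)(v,w)=Q(v,w)+Q(v,x)[Q(x,w)]_++[-Q(v,x)]_+Q(x,w)$, $[a]_+=\max(a,0)$. $\mu_{\mathbf i}$ converges on $Q$ if $(\mu_{i_m}\circ\cdots\circ\mu_{i_1}(Q))_{m\ge1}$ converges in $\mathbf{LF}$, and diverges otherwise; $\mathcal C_{\mathbf{LF}}(\mu_{\mathbf i})$ is the set of $Q\in\mathbf{LF}$ on which it converges, $\mathcal D_{\mathbf{LF}}(\mu_{\mathbf i})=\mathbf{LF}\setminus\mathcal C_{\mathbf{LF}}(\mu_{\mathbf i})$. For $S\subseteq\mathbb{N}$, $\mathbf i_S$ is the (finite or infinite) subsequence of $\mathbf i$ obtained by deleting all entries not in $S$. Reduction: let $\mathbf j=(j_1,j_2,\dots)$ be a finite or infinite sequence in which every value appears finitely often, viewed as a function on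 its set of positions $K_0$. For a sequence viewed as a function $s$ on a set of positions $K\subseteq\mathbb{N}$ (ordered as in $\mathbb{N}$), a block is a maximal set of positions consecutive in $K$ on which $s$ is constant; the one-step reduction $R(s)$ is the restriction of $s$ to the set of least positions of the blocks of odd cardinality (even-size blocks are deleted, odd-size blocks are replaced by their first entry). Iterating gives position sets $K_0\supseteq K_1\supseteq K_2\supseteq\cdots$; with $\bigcap_m K_m=\{k_1<k_2<\cdots\}$ (possibly finite or empty), the reduction $\overline\mu_{\mathbf j}$ is the mutation sequence given by $(j_{k_1},j_{k_2},\dots)$; it is called finite or infinite according to whether this sequence is. *)

(* Defs.v *)
From HB Require Import structures.
From mathcomp Require Import all_boot all_order all_algebra ring.
From mathcomp Require Import finmap all_classical topology.

Set Implicit Arguments.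
Unset Strict Implicit.
Unset Printing Implicit Defensive.

Import Order.TTheory GRing.Theory Num.Theory.

Local Open Scope classical_set_scope.
Local Open Scope ring_scope.

(** * Quivers on the positive integers *)

Definition posnat : Type := {n : nat | (0 < n)%N}.

Definition arrows : Type := posnat -> posnat -> int.

Definition is_quiver (Q : arrows) : Prop := forall x y, Q x y = - Q y x.

(* Finiteness of the sum of nonnegative integers, as boundedness of the sums
   over finite sets. *)
Definition locally_finite (Q : arrows) : Prop :=
  forall x, exists M : int, forall A : {fset posnat},
    \sum_(y <- A) `|Q x y| <= M.

Record LF : Type := MkLF {
  LF_arrows :> arrows;
  LF_quiver : is_quiver LF_arrows;
  LF_finite : locally_finite LF_arrows }.

Lemma LF_inj (Q Q' : LF) : (Q : arrows) = Q' -> Q = Q'.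
Proof.
case: Q Q' => [Q q1 q2] [Q' q1' q2'] /= e; move: e q1 q2 q1' q2' => -> *.
by congr MkLF; exact: Prop_irrelevance.
Qed.

HB.instance Definition _ := gen_eqMixin LF.
HB.instance Definition _ := gen_choiceMixin LF.

Fact zero_is_quiver : is_quiver (fun _ _ => 0).
Proof. by move=> x y; rewrite oppr0. Qed.

Fact zero_locally_finite : locally_finite (fun _ _ => 0).
Proof.
by move=> x; exists 0 => A; rewrite big1// => y _; rewrite normr0.
Qed.

HB.instance Definition _ :=
  isPointed.Build LF (MkLF zero_is_quiver zero_locally_finite).

(** * The topology of [LF] *)

Definition overfill (V : set posnat) (Q : arrows) : arrows :=
  fun x y => if (x \in V) || (y \in V) then Q x y else 0.

Definition LF_basic : set (set LF) :=
  [set B | exists V : set posnat, exists Q : LF,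
     finite_set V /\ B = [set Q' : LF | overfill V Q' = overfill V Q]].

Fact LF_basic_cover : \bigcup_(B in LF_basic) B = setT.
Proof.
rewrite -subTset => Q _.
exists [set Q' : LF | overfill set0 Q' = overfill set0 Q] => //.
by exists set0, Q.
Qed.

Fact overfill_sub (V W : set posnat) (Q Q' : arrows) : V `<=` W ->
  overfill W Q = overfill W Q' -> overfill V Q = overfill V Q'.
Proof.
move=> VW e; apply/funext => x; apply/funext => y.
have := congr1 (fun f => f x y) e; rewrite /overfill.
have [/orP[]/set_mem/VW/mem_set -> //|//] := boolP ((x \in V) || (y \in V)).
by rewrite orbT.
Qed.

Fact LF_basic_join (A B : set LF) (Q : LF) :
  LF_basic A -> LF_basic B -> A Q -> B Q ->
  exists C, [/\ LF_basic C, C Q & C `<=` A `&` B].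
Proof.
move=> [V [P [fV ->]]] [W [P' [fW ->]]] /= eV eW.
exists [set Q' : LF | overfill (V `|` W) Q' = overfill (V `|` W) Q]; split=> //.
  by exists (V `|` W), Q; rewrite finite_setU.
move=> Q' /= e; split=> /=.
- by rewrite -eV; exact: overfill_sub e.
- by rewrite -eW; exact: overfill_sub e.
Qed.

HB.instance Definition _ := isBaseTopological.Build LF
  (b := @idfun (set LF)) LF_basic_cover LF_basic_join.

(** * Mutation *)

Definition pos_part (a : int) : int := Num.max a 0.

Definition mutate_arrows (x : posnat) (Q : arrows) : arrows :=
  fun v w =>
    if (x == v) || (x == w) then - Q v w
    else Q v w + Q v x * pos_part (Q x w) + pos_part (- Q v x) * Q x w.

Fact mutate_is_quiver (x : posnat) (Q : arrows) :
  is_quiver Q -> is_quiver (mutate_arrows x Q).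
Proof.
move=> sQ v w; rewrite /mutate_arrows orbC.
case: ifP => _; first by rewrite sQ.
rewrite (sQ v w) (sQ x w) (sQ v x) !opprK !opprD.
by ring.
Qed.

Fact mutate_bound (x : posnat) (Q : arrows) (v w : posnat) :
  `|mutate_arrows x Q v w| <= `|Q v w| + `|Q x w| *+ (2 * `|Q v x|)%N.
Proof.
rewrite /mutate_arrows; case: ifP => _.
  by rewrite normrN lerDl mulrn_wge0.
have pp (a : int) : `|pos_part a| <= `|a|.
  by rewrite /pos_part; case: (leP a 0) => a0; rewrite ?normr0.
rewrite -addrA; apply: le_trans (ler_normD _ _) _; rewrite lerD2l.
apply: le_trans (ler_normD _ _) _; rewrite !normrM.
rewrite mulrnA -(mulr_natr _ `|Q v x|%N) natz abszE mulr2n mulrDl.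
apply: lerD; first by rewrite mulrC ler_wpM2r.
by rewrite mulrC ler_wpM2l// -(normrN (Q v x)).
Qed.

Fact mutate_locally_finite (x : posnat) (Q : arrows) :
  locally_finite Q -> locally_finite (mutate_arrows x Q).
Proof.
move=> fQ v; have [M hM] := fQ v; have [N hN] := fQ x.
exists (M + N *+ (2 * `|Q v x|)%N) => A.
apply: le_trans (ler_sum _ (fun w _ => mutate_bound x Q v w)) _.
by rewrite big_split/= sumrMnl lerD// lerMn2r hN orbT.
Qed.

Definition mutate (x : posnat) (Q : LF) : LF :=
  MkLF (mutate_is_quiver x (LF_quiver Q)) (mutate_locally_finite x (LF_finite Q)).

(* [mutate_upto i m Q] mutates [Q] at [i 0], then at [i 1], up to [i m.-1]. *)
Fixpoint mutate_upto (i : nat -> posnat) (m : nat) (Q : LF) : LF :=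
  if m is m'.+1 then mutate (i m') (mutate_upto i m' Q) else Q.

Definition converges_LF (i : nat -> posnat) : set LF :=
  [set Q : LF | cvgn (fun m => mutate_upto i m.+1 Q)].

Definition diverges_LF (i : nat -> posnat) : set LF := ~` converges_LF i.

(** * Finite or infinite sequences and their reduction *)

(* A finite or infinite sequence is given by its set of positions, which need
   not be an initial segment, and its values there; [entry] is irrelevant
   outside [positions]. *)
Record posseq : Type := MkPosseq {
  positions : set nat;
  entry : nat -> posnat }.

Definition posseq_of (i : nat -> posnat) : posseq := MkPosseq setT i.

Definition restrict_values (S : set posnat) (s : posseq) : posseq :=
  MkPosseq (positions s `&` entry s @^-1` S) (entry s).

Definition infinite_values (i : nat -> posnat) : set posnat :=
  [set v | infinite_set [set k | i k = v]].

Definition constant_run (s : posseq) (B : set nat) : Prop :=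
  [/\ B !=set0, B `<=` positions s,
      forall a b c, B a -> B b -> positions s c -> (a <= c <= b)%N -> B c &
      forall a b, B a -> B b -> entry s a = entry s b].

Definition block (s : posseq) (B : set nat) : Prop :=
  constant_run s B /\
  forall B', constant_run s B' -> B `<=` B' -> B' = B.

Definition odd_card (B : set nat) : Prop :=
  exists2 n, odd n & (B #= `I_n)%card.

Definition reduce_step (s : posseq) : posseq :=
  MkPosseq
    [set k | exists B, [/\ block s B, odd_card B, B k &
                           forall b, B b -> (k <= b)%N]]
    (entry s).

Definition reduction (s : posseq) : posseq :=
  MkPosseq (\bigcap_m positions (iter m reduce_step s)) (entry s).

Definition finite_length (s : posseq) : Prop := finite_set (positions s).
Definition infinite_length (s : posseq) : Prop := ~ finite_length s.

(* Main.v *)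
(* Mutations are involutions, so a sequence of mutations only matters through its
   reduced word in a free product of copies of Z/2, kept on a stack: reading a
   letter pops it off the top of the stack or pushes it. For a sequence in which
   every letter occurs finitely often, the reduction is infinite exactly when the
   size of the stack tends to infinity.

   If it does not, the stack takes some value [t] infinitely often, so the quiver
   returns infinitely often to a fixed locally finite quiver; the letters read
   late are away from a vertex and its neighbours there, so every row stabilizes.
   Rows of vertices in S_inf are harmless if they vanish; if one does not, it is
   never zero afterwards and changes sign infinitely often.

   If it does, one finds disjoint finite sets of letters A_0, A_1, ..., each read
   after the previous one is exhausted, such that the letters of A_n alone leave a
   nonempty reduced word, with first letter y_n. Suppose that x is joined to y_n
   by at least two arrows when the reading of A_n starts. Put double arrows on
   A_n and y_(n+1), oriented by a linear order with source y_n and sink y_(n+1) (or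
   the opposite one). The first mutation, at y_n, makes a fork of the quiver on x,
   A_n and y_(n+1); mutating a fork elsewhere than at its point of return gives a
   fork, so at the end x is joined to y_(n+1) by at least two arrows. Hence row x
   never stabilizes. *)
Require Import Defs.
From mathcomp Require Import all_boot all_order all_algebra finmap zify ring.
From mathcomp Require Import all_classical topology.

Set Implicit Arguments.
Unset Strict Implicit.
Unset Printing Implicit Defensive.

Import Order.TTheory GRing.Theory Num.Theory.

Local Open Scope classical_set_scope.

(** * Stacks *)

Local Notation reduced := (sorted (fun u v => u != v)).

Section Stack.
Variable T : eqType.
Implicit Types (s t : seq T) (v : T).

Definition push s v : seq T :=
  if s is u :: s' then if u == v then s' else v :: s else [:: v].

Lemma push_reduced s v : reduced s -> reduced (push s v).
Proof.
case: s => //= u s; case: eqVneq => [_|uv] /=; first exact: path_sorted.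
by rewrite eq_sym uv.
Qed.

Lemma pushK s v : reduced s -> push (push s v) v = s.
Proof.
case: s => [|u s] /=; first by rewrite eqxx.
case: (eqVneq u v) => [->|uv] /=; last by rewrite eqxx.
by case: s => //= w s /andP[vw _]; rewrite eq_sym (negPf vw).
Qed.

Lemma size_push s v : (size (push s v) <= (size s).+1)%N.
Proof. by case: s => //= u s; case: ifP => _ //=; lia. Qed.

Lemma push_rcons s v w : w != v -> exists s', push (rcons s v) w = rcons s' v.
Proof.
case: s => [|u s] wv /=; first by rewrite eq_sym (negPf wv); exists [:: w].
by case: ifP => _; [exists s | exists (w :: u :: s)].
Qed.

(** Skipped positions still advance the time, so that stacks for different [K] run on the same clock
    and can be compared. *)
Definition stack (K : set nat) (i : nat -> T) : nat -> seq T :=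
  fix stk m := if m is m'.+1 then
    if m' \in K then push (stk m') (i m') else stk m' else [::].

Lemma stackS K i m :
  stack K i m.+1 = if m \in K then push (stack K i m) (i m) else stack K i m.
Proof. by []. Qed.

Lemma stack_reduced K i m : reduced (stack K i m).
Proof. by elim: m => //= m IH; case: ifP => _ //; exact: push_reduced. Qed.

Lemma size_stack K i m : (size (stack K i m) <= m)%N.
Proof.
elim: m => //= m IH; case: ifP => _; last exact: leqW.
exact: leq_trans (size_push _ _) _.
Qed.

Lemma eq_stack K K' i m : (forall k, (k < m)%N -> (k \in K) = (k \in K')) ->
  stack K i m = stack K' i m.
Proof.
elim: m => //= m IH KK'; rewrite KK'// IH// => k km; exact/KK'/leqW.
Qed.

Lemma stack_const K i m n : (m <= n)%N ->
  (forall k, (m <= k < n)%N -> k \notin K) -> stack K i n = stack K i m.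
Proof.
elim: n => [|n IH]; first by rewrite leqn0 => /eqP->.
rewrite leq_eqVlt => /predU1P[->//|]; rewrite ltnS => mn Km /=.
rewrite (negPf (Km n _)) ?mn ?ltnSn// IH// => k /andP[mk kn].
by apply: Km; rewrite mk ltnW.
Qed.

(* Seen as elements of a free product of copies of Z/2, written from the bottom
   of the stack to its top, [s] and [t] differ by a generator on the left. *)
Definition differ1 s t := exists v, t = rcons s v \/ s = rcons t v.

(** Letters are read at the top while the extra generator sits at the bottom, so the two interact
    only on an empty stack. *)
Lemma differ1_push s t u : differ1 s t -> differ1 (push s u) (push t u).
Proof.
have aux p v : differ1 (push p u) (push (rcons p v) u).
  case: p => [|a p] /=; last first.
    by exists v; left; case: ifP.
  (* Reading [v] itself turns [[::]] and [[:: v]] into each other, hence the exchange of roles. *)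
  by exists v; case: eqVneq => [->|_]; [right|left].
by case=> v [->|->]; [exact: aux|have [w []] := aux t v => ->; exists w; auto].
Qed.

Definition tends_infty (f : nat -> nat) :=
  forall r, exists N, forall m, (N <= m)%N -> (r <= f m)%N.

(* Restarting from the empty stack at time [n] changes the later sizes by at most
   the size of the stack at time [n]. *)
Lemma size_stack_shift K i n : exists c, forall m, (n <= m)%N ->
  (size (stack (K `&` [set k | (n <= k)%N]) i m) <= size (stack K i m) + c /\
   size (stack K i m) <= size (stack (K `&` [set k | (n <= k)%N]) i m) + c)%N.
Proof.
pose run s m := foldl (fun s k => if k \in K then push s (i k) else s) s
  (iota n (m - n)).
have runE K' s m : (forall k, (n <= k)%N -> (k \in K') = (k \in K)) ->
    stack K' i n = s -> (n <= m)%N -> stack K' i m = run s m.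
  move=> KK' <-; elim: m => [|m IH].
    by rewrite leqn0 /run => /eqP ->; rewrite subnn.
  rewrite leq_eqVlt => /predU1P[nm|nm]; first by rewrite /run nm subnn.
  by rewrite stackS IH// /run subSn// -addn1 iotaD foldl_cat /= subnKC// KK'.
have run1 s t m : differ1 s t -> differ1 (run s m) (run t m).
  rewrite /run; elim: (iota _ _) s t => //= k l IH s t st; apply: IH.
  by case: ifP => // _; exact: differ1_push.
have runc s m : (size (run [::] m) <= size (run s m) + size s /\
    size (run s m) <= size (run [::] m) + size s)%N.
  (* Each bottom letter of [s] is one generator of difference at the start, hence at most one unit
     of size at the end. *)
  elim/last_ind: s => [|s v [IH1 IH2]]; first by rewrite addn0.
  have /(@run1 _ _ m) [w] : differ1 s (rcons s v) by exists v; left.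
  rewrite (size_rcons s v).
  by case=> /(congr1 size); rewrite size_rcons; lia.
exists (size (stack K i n)) => m nm.
rewrite (runE _ [::] _ _ _ nm); last 2 first.
- move=> k nk; apply/idP/idP; rewrite !inE; first by case.
  by split.
- rewrite (@stack_const _ _ 0)// => k /= kn; apply/negP; rewrite inE => -[_] /=.
  lia.
by rewrite (runE K (stack K i n))//.
Qed.

(** Restarted at time [n], the two stacks coincide, and each restart costs only a constant. *)
Lemma tends_infty_stack_restrict K K' i n :
  (forall k, (n <= k)%N -> (k \in K) = (k \in K')) ->
  tends_infty (fun m => size (stack K i m)) ->
  tends_infty (fun m => size (stack K' i m)).
Proof.
move=> KK' h r; have [c hc] := size_stack_shift K i n.
have [c' hc'] := size_stack_shift K' i n.
have [N hN] := h (r + c + c')%N; exists (N + n)%N => m Nm.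
have nm : (n <= m)%N by lia.
have := hN m; have [] := hc _ nm; have [] := hc' _ nm.
rewrite (@eq_stack (K' `&` _) (K `&` [set k | (n <= k)%N])); first lia.
move=> k _; have [/KK' e|kn] := leqP n k.
  by apply/idP/idP; rewrite !inE => -[a b]; split => //; apply/set_mem;
    [rewrite e|rewrite -e]; exact/mem_set.
by apply/idP/idP; rewrite !inE /= => -[_]; lia.
Qed.

(** Let [r] be the lower limit of the sizes. Once the size never drops below [r], the bottom [r]
    letters cannot be popped, so all later stacks of size [r] are the same stack [s]. *)
Lemma stack_bounded_repeats K i :
  ~ tends_infty (fun m => size (stack K i m)) ->
  exists s N, (forall n, exists2 m, (n <= m)%N & stack K i m = s) /\
    forall m, (N <= m)%N -> exists p, stack K i m = p ++ s.
Proof.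
move=> nt.
pose P r := `[< forall n, exists2 m, (n <= m)%N & (size (stack K i m) <= r)%N >].
have /ex_minnP[r /asboolP Pr minr] : exists r, P r.
  apply: contrapT => /forallNP nP; apply: nt => r.
  have := nP r; rewrite /P asboolE => /existsNP[n /forall2NP hn]; exists n => m nm.
  by have [//|/negP] := hn m; rewrite -ltnNge => /ltnW.
have [N hN] : exists N, forall m, (N <= m)%N -> (r <= size (stack K i m))%N.
  case: r Pr minr => [|r] Pr minr; first by exists 0.
  have : ~ P r by move=> /minr; rewrite ltnn.
  rewrite /P asboolE => /existsNP[n /forall2NP hn]; exists n => m nm.
  by have [//|/negP] := hn m; rewrite -ltnNge.
have [m0 Nm0 e0] := Pr N.
have sz0 : size (stack K i m0) = r by apply/eqP; rewrite eqn_leq e0 hN.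
have app m : (m0 <= m)%N -> exists p, stack K i m = p ++ stack K i m0.
  elim: m => [|m IH]; first by rewrite leqn0 => /eqP ->; exists [::].
  rewrite leq_eqVlt => /predU1P[<-|]; first by exists [::].
  rewrite ltnS => m0m; have [p e] := IH m0m.
  have := hN m.+1 (leq_trans Nm0 (leqW m0m)).
  rewrite stackS; case: ifP => _; last by exists p.
  rewrite e; case: p {e} => [|a p] /=; last first.
    by case: ifP => _; [exists p|exists (i m :: a :: p)].
  case: (stack K i m0) sz0 => [|b q] /= <-; first by exists [:: i m].
  by case: ifP => _; [rewrite ltnn|exists [:: i m]].
exists (stack K i m0), m0; split => // n.
have [m nm em] := Pr (maxn n m0).
exists m; first by rewrite (leq_trans _ nm) ?leq_maxl.
have m0m : (m0 <= m)%N by rewrite (leq_trans _ nm) ?leq_maxr.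
have [p e] := app _ m0m; move: em; rewrite e size_cat sz0.
by case: p {e} => //= a p; lia.
Qed.

End Stack.

(** * Blocks and the reduction *)

Lemma seq_card_eq (T : choiceType) (l : seq T) : uniq l ->
  ([set` l] #= `I_(size l))%card.
Proof.
move=> ul; have -> : [set` l] = [set` [fset x | x in l]%fset].
  by apply/seteqP; split => x; rewrite /= in_fset.
by apply/card_eq_fsetP; rewrite card_fseq undup_id.
Qed.

(** The least position of a block of either parity, expressed without blocks or cardinalities. *)
Definition block_start (s : posseq) (n : nat) : Prop :=
  positions s n /\ ~ exists p, [/\ positions s p, (p < n)%N &
    forall c, positions s c -> (p <= c <= n)%N -> entry s c = entry s n].

(** An earlier [p] with the same letter all the way to [n] would allow [B] to be enlarged by the
    positions from [p] to [n]. *)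
Lemma reduce_step_start s n : positions (reduce_step s) n -> block_start s n.
Proof.
move=> [B [[[[b0 Bb0] Bs Bconv Bc] Bmax] _ Bn nB]].
split; first exact: Bs.
move=> [p [sp pn pc]].
have eB b : B b -> entry s b = entry s n by move=> Bb; exact: Bc.
have BE := Bmax (B `|` [set c | positions s c /\ (p <= c <= n)%N]).
suff /BE e : constant_run s (B `|` [set c | positions s c /\ (p <= c <= n)%N]).
  have : B p by rewrite -e => [|x Bx]; [right; rewrite /= leqnn ltnW|left].
  by move/nB; rewrite leqNgt pn.
split; first by exists b0; left.
- by move=> x [/Bs|[]].
- move=> a b c ha hb sc /andP[ac cb].
  have pa : (p <= a)%N by case: ha => [/nB|[_ /andP[]//]]; lia.
  have [cn|nc] := leqP c n; first by right; split => //; rewrite (leq_trans pa).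
  left; case: hb => [Bb|[_]]; last by lia.
  by apply: Bconv sc _; [exact: Bn|exact: Bb|rewrite ltnW].
- have e x : (B `|` [set c | positions s c /\ (p <= c <= n)%N]) x ->
    entry s x = entry s n by case=> [/eB//|[/pc]].
  by move=> a b /e -> /e ->.
Qed.

Lemma reduce_step_sub s : positions (reduce_step s) `<=` positions s.
Proof. by move=> n /reduce_step_start[]. Qed.

(** Equal consecutive letters cancel in pairs by [pushK], so only the parity of the run counts. *)
Lemma stack_run (K : set nat) (T : eqType) (i : nat -> T) v s n : (s <= n)%N ->
  (forall k, K k -> (s <= k < n)%N -> i k = v) ->
  let c := count (mem K) (iota s (n - s)) in
  stack K i n = if odd c then push (stack K i s) v else stack K i s.
Proof.
elim: n => [|n IH]; first by rewrite leqn0 => /eqP ->.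
rewrite leq_eqVlt => /predU1P[<-|]; first by rewrite subnn.
rewrite ltnS => sn Kv /=; rewrite IH//; last first.
  by move=> k Kk /andP[sk kn]; apply: Kv; rewrite // sk leqW.
rewrite subSn// -addn1 iotaD count_cat /= subnKC// addn0 oddD.
case: ifPn => nK; last by rewrite addbF.
rewrite (Kv n) ?sn ?ltnSn//; last exact/set_mem.
case: (odd _) => //=.
by rewrite pushK ?stack_reduced.
Qed.

(** Strong induction, passing from [n] to the start [a] of the preceding block: that block acts by
    its parity, which is what [reduce_step] retains. Inside a block the two stacks may differ, hence
    the restriction to block starts. *)
Lemma stack_reduce_step s n : block_start s n ->
  stack (positions s) (entry s) n = stack (positions (reduce_step s)) (entry s) n.
Proof.
set K := positions s; set K' := positions (reduce_step s); set i := entry s.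
elim/ltn_ind: n => n IH [Kn nstart].
have [[p0 /andP[p0n /set_mem Kp0]]|noK] :=
    pselect (exists p, (p < n)%N && (p \in K)); last first.
  have noK1 k : (k < n)%N -> k \notin K.
    by move=> kn; apply/negP => kK; apply: noK; exists k; rewrite kn.
  have noK'1 k : (k < n)%N -> k \notin K'.
    by move/noK1; apply: contra; rewrite !inE; exact: reduce_step_sub.
  by rewrite (@stack_const _ K _ 0)// (@stack_const _ K' _ 0).
have [p /andP[pn /set_mem Kp] pmax] :
    exists2 p, (p < n)%N && (p \in K) & forall k, (k < n)%N && (k \in K) -> (k <= p)%N.
  have [||p hp pmax] := @ex_maxnP (fun p => (p < n)%N && (p \in K)) n.
  - by exists p0; rewrite p0n mem_set.
  - by move=> k /andP[/ltnW].
  - by exists p.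
have ipn : i p != i n.
  apply/eqP => ipn; apply: nstart; exists p; split => // c Kc /andP[pc].
  rewrite leq_eqVlt => /predU1P[-> //|cn].
  by have := pmax c; rewrite cn mem_set// => /(_ isT) cp; have <- : p = c by lia.
(* The least [a] satisfying [run] is the start of the block of [p], the last position before [n]. *)
pose run a := `[< [/\ K a, (a <= p)%N & forall c, K c -> (a <= c <= p)%N -> i c = i p] >].
have runp : run p by apply/asboolP; split => // c _ ?; congr i; lia.
have [a /asboolP[Ka ap ac] amin] : exists2 a, run a & forall b, run b -> (a <= b)%N.
  by have [|a ra amin] := @ex_minnP run; [exists p|exists a].
have an : (a < n)%N by lia.
have sa : block_start s a.
  split => // -[b [Kb ba bc]]; suff /amin : run b by lia.
  apply/asboolP; split => //; first by lia.
  move=> c Kc /andP[bc' cp]; have [ac'|ca] := leqP a c; first by apply: ac; rewrite ?ac'.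
  apply: etrans (bc _ Kc _) (ac _ Ka _); first by rewrite bc' ltnW.
  by rewrite leqnn.
have iv k : K k -> (a <= k < n)%N -> i k = i p.
  move=> Kk /andP[ak kn]; apply: ac => //; rewrite ak; apply: pmax.
  by rewrite kn mem_set.
pose B := [set k | K k /\ (a <= k < n)%N].
have Brun : constant_run s B.
  split.
  - by exists a; split=> //; rewrite leqnn.
  - by move=> k [].
  - by move=> x y c [_ ?] [_ ?] Kc ?; split => //; lia.
  - by move=> x y [Kx hx] [Ky hy]; apply: etrans (iv _ Kx hx) (esym (iv _ Ky hy)).
have BB B' : constant_run s B' -> B' a -> (forall b, B' b -> (a <= b)%N) -> B' `<=` B.
  move=> [_ B's B'conv B'c] B'a aB' x B'x; split; first exact: B's.
  rewrite (aB' _ B'x) /=; rewrite ltnNge; apply/negP => nx.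
  have B'n : B' n by apply: B'conv B'a B'x _ _; rewrite // ltnW.
  have := B'c _ _ B'n B'a; rewrite -/i (iv a)// ?leqnn//.
  by move/eqP; rewrite eq_sym (negPf ipn).
have Ba : B a by split => //; rewrite leqnn.
have aB b : B b -> (a <= b)%N by move=> [_ /andP[]].
have Bblock : block s B.
  split => // B' rB' BB'; apply/seteqP; split => //; apply: BB => //; first exact: BB'.
  move=> b B'b; rewrite leqNgt; apply/negP => ba.
  case: sa => _; apply; exists b; case: rB' => [_ B's B'conv B'c]; split => //.
    exact: B's.
  move=> c Kc hc; apply: B'c; last exact: BB'.
  by apply: B'conv B'b (BB' _ Ba) Kc hc.
have Bcard : (B #= `I_(count (mem K) (iota a (n - a))))%card.
  rewrite -size_filter; have -> : B = [set` [seq k <- iota a (n - a) | k \in K]].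
    have an' : (a + (n - a) = n)%N by rewrite subnKC// ltnW.
    apply/seteqP; split => k; rewrite /B /= mem_filter mem_iota an'.
      by case=> Kk ak; apply/andP; split => //; apply: mem_set.
    by case/andP => /set_mem Kk ak; split.
  by apply: seq_card_eq; rewrite filter_uniq// iota_uniq.
(* The block is [B], and its first position survives exactly when its cardinality is odd. *)
have K'a : (a \in K') = odd (count (mem K) (iota a (n - a))).
  apply/idP/idP => [/set_mem[B' [[rB' mB'] [m om cm] B'a aB']]|oB].
    have BE : B = B' by apply: mB' => //; exact: BB.
    suff -> : count (mem K) (iota a (n - a)) = m by [].
    apply/card_eq_II; apply: card_eq_trans cm; rewrite -BE card_eq_sym.
    exact: Bcard.
  apply/mem_set; exists B; split => //.
  by exists (count (mem K) (iota a (n - a))).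
rewrite (stack_run (ltnW an) iv) (IH _ an sa) -K'a.
rewrite (@stack_const _ K' _ a.+1 n)// ?stackS; first by rewrite (ac a)// leqnn.
move=> k /andP[ak kn]; apply/negP => /set_mem/reduce_step_start[Kk]; apply.
exists a; split => // c Kc /andP[ac' ck].
apply: etrans (iv c Kc _) (esym (iv k Kk _)); first by rewrite ac' (leq_ltn_trans ck).
by rewrite ltnW.
Qed.

Lemma iter_reduce_stepE s m : entry (iter m reduce_step s) = entry s.
Proof. by elim: m. Qed.

Lemma iter_reduce_step_sub s m n : (m <= n)%N ->
  positions (iter n reduce_step s) `<=` positions (iter m reduce_step s).
Proof.
elim: n => [|n IH]; first by rewrite leqn0 => /eqP ->.
rewrite leq_eqVlt => /predU1P[-> //|/IH]; apply: subset_trans.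
exact: reduce_step_sub.
Qed.

Lemma stack_iter_reduce_step s m n : block_start (iter m reduce_step s) n ->
  stack (positions s) (entry s) n =
  stack (positions (iter m.+1 reduce_step s)) (entry s) n.
Proof.
elim: m => [|m IH] bn; first exact: stack_reduce_step.
rewrite (IH (reduce_step_start bn.1)).
by rewrite -[entry s](iter_reduce_stepE s m.+1) stack_reduce_step.
Qed.

Lemma stack_surviving s m n : positions (iter m reduce_step s) n ->
  stack (positions s) (entry s) n =
  stack (positions (iter m reduce_step s)) (entry s) n.
Proof. by case: m => // m /reduce_step_start; exact: stack_iter_reduce_step. Qed.

(** The position sets decrease and only finitely many positions lie below [n]. *)
Lemma stabilize_below s n : exists m, forall k, (k < n)%N ->
  (k \in positions (iter m reduce_step s)) = (k \in positions (reduction s)).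
Proof.
elim: n => [|n [m IH]]; first by exists 0.
have [nK|/existsNP[l nl]] :=
    pselect (forall l, positions (iter l reduce_step s) n).
  exists m => k; rewrite ltnS leq_eqVlt => /predU1P[->|/IH//].
  by rewrite !mem_set// => l _.
exists (maxn m l) => k; rewrite ltnS leq_eqVlt => /predU1P[->|kn].
  apply/idP/idP => /set_mem h; exfalso; apply: nl.
    by apply: iter_reduce_step_sub h; rewrite leq_maxr.
  exact: h.
apply/idP/idP => /set_mem h; apply/mem_set.
  apply/set_mem; rewrite -IH//; apply/mem_set.
  by apply: iter_reduce_step_sub h; rewrite leq_maxl.
exact: h.
Qed.

(** At a stage where the positions below [n] are already final, equal letters at [p] and [n] would
    lie in one block, and [n] would not survive the next step. *)
Lemma reduction_adjacent s p n : positions (reduction s) p ->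
  positions (reduction s) n -> (p < n)%N ->
  (forall c, (p < c < n)%N -> c \notin positions (reduction s)) ->
  entry s p != entry s n.
Proof.
move=> Rp Rn pn pcn; have [m hm] := stabilize_below s n.
have : positions (iter m.+1 reduce_step s) n by exact: Rn.
move=> /reduce_step_start[_ nst]; apply/eqP => e; apply: nst.
exists p; split; [exact: Rp|by []|].
rewrite iter_reduce_stepE => c Kc /andP[pc cn].
have [->|np] := eqVneq c p; first by [].
have [->//|nn] := eqVneq c n.
by have := pcn c; rewrite -hm ?mem_set//=; lia.
Qed.

(** The top of the stack is always the letter at the previous surviving position, which differs from
    the next one; so nothing is ever popped. *)
Lemma stack_reductionS s n : positions (reduction s) n ->
  stack (positions (reduction s)) (entry s) n.+1 =
  entry s n :: stack (positions (reduction s)) (entry s) n.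
Proof.
move=> Rn; rewrite stackS mem_set//.
have : stack (positions (reduction s)) (entry s) n = [::] \/ exists p q,
  [/\ positions (reduction s) p, (p < n)%N,
      forall c, (p < c < n)%N -> c \notin positions (reduction s) &
      stack (positions (reduction s)) (entry s) n = entry s p :: q].
  elim/ltn_ind: n {Rn} => -[|n] IH; first by left.
  rewrite stackS; case: ifPn => [/set_mem Rn|nR]; last first.
    have [//|->|[p [q [Rp pn pc ->]]]] := IH n; first by left.
    right; exists p, q; split => //; first exact: leqW.
    move=> c /andP[pc']; rewrite ltnS leq_eqVlt => /predU1P[->//|cn].
    by apply: pc; rewrite pc'.
  right; exists n; have [//|->|[p [q [Rp pn pc ->]]]] := IH n.
    by exists [::]; split => // c; lia.
  exists (entry s p :: q); split => //; first by move=> c; lia.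
  by rewrite /= (negPf (reduction_adjacent Rp Rn pn pc)).
case=> [->//|[p [q [Rp pn pc ->]]]] /=.
by rewrite (negPf (reduction_adjacent Rp Rn pn pc)).
Qed.

Lemma stack_reduction s n : positions (reduction s) n ->
  stack (positions s) (entry s) n = stack (positions (reduction s)) (entry s) n.
Proof.
move=> Rn; have [m hm] := stabilize_below s n.
by rewrite (@stack_surviving s m n (Rn m I)) (eq_stack _ hm).
Qed.

(** * Length of the reduction and growth of the stack *)

Definition finite_mult (s : posseq) : Prop :=
  forall v, finite_set [set k | positions s k /\ entry s k = v].

Lemma finite_nat_bound (A : set nat) : finite_set A ->
  exists N, forall k, A k -> (k < N)%N.
Proof.
move=> /finite_seqP[l ->]; exists (\max_(k <- l) k).+1 => k /= kl.
by rewrite ltnS; apply: (@leq_bigmax_seq _ l xpredT id).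
Qed.

Lemma infinite_nat_beyond (A : set nat) N : infinite_set A ->
  exists2 k, A k & (N <= k)%N.
Proof.
move=> iA; apply: contrapT => /forall2NP h; apply: iA.
apply: sub_finite_set (finite_II N) => k Ak /=.
by have [//|/negP] := h k; rewrite -ltnNge.
Qed.

(** Stacks read from positions below a fixed [N] have size at most [N]. If some stage of the
    reduction is finite, such stacks occur at late block starts of the stage before the first finite
    one. If all stages are infinite, a stage agreeing with the reduction far enough has a first
    position after that range, and the stack there is of this kind. *)
Lemma finite_length_reduction s : finite_mult s -> finite_length (reduction s) ->
  ~ tends_infty (fun m => size (stack (positions s) (entry s) m)).
Proof.
move=> fm fr tinf.
have step m N : (forall k, positions (iter m reduce_step s) k -> (k < N)%N) ->
    (forall n, exists n', [/\ (n <= n')%N, (N <= n')%N &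
       stack (positions s) (entry s) n' =
       stack (positions (iter m reduce_step s)) (entry s) n']) -> False.
  move=> bN h; have [M hM] := tinf N.+1.
  have [n [Mn Nn e]] := h M; have := hM _ Mn; rewrite e (@stack_const _ _ _ N n)//.
    by rewrite ltnNge size_stack.
  by move=> k /andP[Nk _]; apply/negP => /set_mem/bN; rewrite ltnNge Nk.
have [[m0 fm0]|/forallNP iK] :=
    pselect (exists m, finite_set (positions (iter m reduce_step s))).
  have /ex_minnP[m /asboolP {}fm0 minm] :
      exists m, `[< finite_set (positions (iter m reduce_step s)) >].
    by exists m0; apply/asboolP.
  have [N bN] := finite_nat_bound fm0.
  apply: (step m N bN) => n; case: m => [|m] in fm0 minm bN *.
    by exists (maxn n N); rewrite leq_maxl leq_maxr.
  have im : infinite_set (positions (iter m reduce_step s)).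
    by move=> /asboolP/minm; rewrite ltnn.
  set Km := positions _ in im.
  (* Beyond [N1] no letter read before [maxn n N] occurs again, so the block of a position [q]
     beyond [N1] also starts after [maxn n N]. *)
  have [N1 hN1] : exists N1, forall k, (exists2 j, (j < maxn n N)%N &
      positions s k /\ entry s k = entry s j) -> (k < N1)%N.
    apply: finite_nat_bound.
    apply: (@sub_finite_set _ _ (\bigcup_(j in `I_(maxn n N))
      [set k | positions s k /\ entry s k = entry s j])).
      by move=> k [j jn hk]; exists j.
    by apply: bigcup_finite => // j _; exact: fm.
  have [q Kq N1q] := infinite_nat_beyond N1 im.
  pose P a := `[< Km a /\ forall c, Km c -> (a <= c <= q)%N -> entry s c = entry s q >].
  have /ex_minnP[a /asboolP[Ka ac] mina] : exists a, P a.
    by exists q; apply/asboolP; split => // c _ ?; congr entry; lia.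
  have aq : (a <= q)%N.
    by apply: mina; apply/asboolP; split => // c _ ?; congr entry; lia.
  exists a.
  have an : (maxn n N <= a)%N.
    rewrite leqNgt; apply/negP => an.
    suff /hN1 : exists2 j, (j < maxn n N)%N & positions s q /\ entry s q = entry s j.
      by rewrite ltnNge N1q.
    exists a => //; split; first exact: (@iter_reduce_step_sub s 0 m).
    by rewrite ac// leqnn.
  have bs : block_start (iter m reduce_step s) a.
    split => // -[p [Kp pa]]; rewrite iter_reduce_stepE => pc.
    have : P p.
      apply/asboolP; split => // c Kc /andP[pc' cq].
      have [ca|ac'] := leqP c a; last by apply: ac; rewrite // ltnW.
      by apply: etrans (pc c Kc _) (ac a Ka _); rewrite ?pc' ?leqnn.
    by move/mina; rewrite leqNgt pa.
  have [na Na] : (n <= a)%N /\ (N <= a)%N by lia.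
  split => //.
  exact: stack_iter_reduce_step.
have [N bN] := finite_nat_bound fr.
have [M hM] := tinf N.+1.
have [m hm] := stabilize_below s (maxn M N).+1.
have [q0 Kq0 Mq0] := infinite_nat_beyond (maxn M N) (iK m).
pose P a := (maxn M N <= a)%N && (a \in positions (iter m reduce_step s)).
have /ex_minnP[q /andP[Mq /set_mem Kq] minq] : exists q, P q.
  by exists q0; rewrite /P Mq0 mem_set.
have := hM q; rewrite (leq_trans _ Mq) ?leq_maxl// (stack_surviving Kq) => /(_ isT).
rewrite ltnNge (@stack_const _ _ _ N) ?size_stack//.
  by rewrite (leq_trans _ Mq) ?leq_maxr.
move=> k /andP[Nk kq]; apply/negP => kK.
have [Mk|kM] := leqP (maxn M N) k.
  by have := minq k; rewrite /P Mk kK => /(_ isT); rewrite leqNgt kq.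
have : k \in positions (reduction s) by rewrite -hm// leqW.
by move=> /set_mem/bN; rewrite ltnNge Nk.
Qed.

Lemma cat_injr (T : eqType) (p q t u : seq T) :
  size t = size u -> p ++ t = q ++ u -> p = q.
Proof.
move=> tu e; have /eqP := e; rewrite eqseq_cat => [/andP[/eqP]//|].
by have := congr1 size e; rewrite !size_cat tu; lia.
Qed.

(** This follows the part of the stack above a persistent bottom [t]: only reading [v] can bring [v]
    there. *)
Lemma push_suffix_notin (T : eqType) (p p' t : seq T) v w :
  v != w -> v \notin p -> push (p ++ t) w = p' ++ t -> v \notin p'.
Proof.
move=> vw; case: p => [|a p] /= vp.
  case: t => [|b t] /=; first by rewrite cats0 => <-; rewrite inE.
  case: ifP => _ e; first by have := congr1 size e; rewrite size_cat /=; lia.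
  by have /(cat_injr erefl) <- : [:: w] ++ b :: t = p' ++ b :: t by []; rewrite inE.
case: ifP => _ e.
  have /(cat_injr erefl) <- : p ++ t = p' ++ t by [].
  by move: vp; rewrite inE negb_or => /andP[].
have /(cat_injr erefl) <- : (w :: a :: p) ++ t = p' ++ t by [].
by rewrite inE negb_or vw.
Qed.

Lemma cat_suffix (T : Type) n (l : seq T) : (n < size l)%N ->
  exists p v q, l = p ++ v :: q /\ size q = n.
Proof.
elim: l => //= a l IH; rewrite ltnS leq_eqVlt => /predU1P[->|/IH].
  by exists [::], a, l.
by move=> [p [v [q [-> <-]]]]; exists (a :: p), v, q.
Qed.

(** Otherwise some [t] recurs and stays at the bottom. Along the reduction the stacks only grow, so
    some letter [v] settles just above height [size t]. But after a return to [t] later than the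
    last reading of [v], the letter [v] cannot appear above [t]. *)
Lemma infinite_length_reduction s : finite_mult s ->
  infinite_length (reduction s) ->
  tends_infty (fun m => size (stack (positions s) (entry s) m)).
Proof.
set R := positions (reduction s); set i := entry s; set K := positions s.
move=> fm ir; apply: contrapT => /stack_bounded_repeats[t [N [rep app]]].
have suf n m : (n <= m)%N -> exists p, stack R i m = p ++ stack R i n.
  elim: m => [|m IH]; first by rewrite leqn0 => /eqP ->; exists [::].
  rewrite leq_eqVlt => /predU1P[->|]; first by exists [::].
  rewrite ltnS => /IH[p e]; have [Rm|nR] := boolP (m \in R).
    rewrite stack_reductionS; last exact/set_mem.
    by exists (i m :: p); rewrite e.
  by rewrite stackS (negPf nR) e; exists p.
have [n0 hn0] : exists n, (size t < size (stack R i n))%N.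
  have: forall r, exists n, (r <= size (stack R i n))%N; last by apply.
  elim=> [|r [n IH]]; first by exists 0.
  have [k Rk nk] := infinite_nat_beyond n ir.
  exists k.+1; rewrite stack_reductionS//=; have [p ->] := suf n k nk.
  by rewrite size_cat ltnS (leq_trans IH)// leq_addl.
have [p0 [v [q [e0 sq]]]] := cat_suffix hn0.
have [M hM] := finite_nat_bound (fm v).
have [m Mm em] := rep (maxn M N).
have [n Rn mn] := infinite_nat_beyond (maxn m n0) ir.
have [p [ep vp]] : exists p, stack K i n = p ++ t /\ v \notin p.
  have {mn} : (m <= n)%N by rewrite (leq_trans _ mn) ?leq_maxl.
  elim: n {Rn} => [|n IH].
    by rewrite leqn0 => /eqP m0; exists [::]; rewrite -em m0.
  rewrite leq_eqVlt => /predU1P[<-|]; first by exists [::]; rewrite em.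
  rewrite ltnS => mn; have [p [ep vp]] := IH mn.
  have [p' ep'] : exists p', stack K i n.+1 = p' ++ t.
    by apply: app; rewrite (leq_trans _ (leqW mn))// (leq_trans _ Mm) ?leq_maxr.
  move: (ep'); rewrite stackS; case: ifPn => [/set_mem Kn|_]; last first.
    by rewrite ep => _; exists p.
  have vn : v != i n.
    apply/eqP => e; have := hM n (conj Kn (esym e)).
    by rewrite ltnNge (leq_trans _ mn)// (leq_trans _ Mm) ?leq_maxl.
  rewrite ep => e; exists p'; split; first by rewrite -e.
  exact: push_suffix_notin e.
have [p1 e1] : exists p1, stack K i n = p1 ++ stack R i n0.
  rewrite [stack K i n](stack_reduction Rn); apply: suf.
  by rewrite (leq_trans _ mn)// leq_maxr.
move: vp; suff -> : p = p1 ++ p0 ++ [:: v] by rewrite !mem_cat inE eqxx !orbT.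
by apply: (cat_injr (esym sq)); rewrite -ep e1 e0 -!catA.
Qed.

(** * Mutation of quivers *)

Local Open Scope ring_scope.

Definition zero_row (Q : arrows) (x : posnat) : Prop := forall y, Q x y = 0.

Definition add_arrows (Q D : arrows) : arrows := fun x y => Q x y + D x y.

(** The top of the stack is the last mutation performed, hence [foldr]. *)
Definition act (s : seq posnat) (Q : arrows) : arrows := foldr mutate_arrows Q s.

Lemma quiver_diag Q x : is_quiver Q -> Q x x = 0.
Proof. by move=> /(_ x x); lia. Qed.

Lemma pos_part0 : pos_part 0 = 0.
Proof. by []. Qed.

Lemma pos_part_pos a : 0 < a -> pos_part a = a.
Proof. by move=> a0; rewrite /pos_part; apply/max_idPl/ltW. Qed.

Lemma pos_part_neg a : a <= 0 -> pos_part a = 0.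
Proof. by move=> a0; rewrite /pos_part; apply/max_idPr. Qed.

Lemma pos_partB a : pos_part a - pos_part (- a) = a.
Proof. by rewrite /pos_part; case: (leP a 0); case: (leP (- a) 0); lia. Qed.

Lemma quiver_eq0 Q x y : is_quiver Q -> Q x y = 0 -> Q y x = 0.
Proof. by move=> qQ e; rewrite qQ e oppr0. Qed.

Lemma zero_rowC Q x y : is_quiver Q -> zero_row Q x -> Q y x = 0.
Proof. by move=> qQ /(_ y); exact: quiver_eq0. Qed.

Lemma mutate_arrowsK k Q : is_quiver Q -> mutate_arrows k (mutate_arrows k Q) = Q.
Proof.
move=> qQ; apply/funext => x; apply/funext => y; rewrite /mutate_arrows eqxx /=.
case: ifPn => [->|/negPf ->]; first by rewrite opprK.
rewrite orbT opprK.
move: (Q x k) (Q k y) => a b.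
(* Writing [a] and [b] as differences of their positive and negative parts turns the cancellation of
   the corrections into a polynomial identity. *)
have ea := pos_partB a; have eb := pos_partB b.
move: (pos_part a) (pos_part (- a)) (pos_part b) (pos_part (- b)) ea eb.
by move=> a1 a2 b1 b2 <- <-; ring.
Qed.

Lemma mutate_zero_row k Q : is_quiver Q -> zero_row Q k -> mutate_arrows k Q = Q.
Proof.
move=> qQ z; apply/funext => x; apply/funext => y; rewrite /mutate_arrows.
rewrite (zero_rowC x qQ z) z oppr0 pos_part0 !(mul0r, mulr0, addr0).
by case: ifP => // /orP[] /eqP <-; rewrite ?z ?(zero_rowC x qQ z) oppr0.
Qed.

Lemma mutate_row k Q x y : k != x -> Q x k = 0 -> is_quiver Q ->
  mutate_arrows k Q x y = Q x y.
Proof.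
move=> kx e qQ; rewrite /mutate_arrows (negPf kx) /= e oppr0 pos_part0 !mul0r !addr0.
by case: eqP => // <-; rewrite e oppr0.
Qed.

Lemma zero_row_mutate k Q x : is_quiver Q -> zero_row Q x ->
  zero_row (mutate_arrows k Q) x.
Proof.
move=> qQ z y; have [->|kx] := eqVneq k x.
  by rewrite /mutate_arrows eqxx z oppr0.
by rewrite mutate_row.
Qed.

(** Mutation is an involution that preserves zero rows. *)
Lemma nonzero_row_mutate k Q x : is_quiver Q -> ~ zero_row Q x ->
  ~ zero_row (mutate_arrows k Q) x.
Proof.
move=> qQ nz z; apply: nz; rewrite -(mutate_arrowsK k qQ).
by apply: zero_row_mutate => //; exact: mutate_is_quiver.
Qed.

Lemma mutate_add k Q D : is_quiver D -> zero_row D k ->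
  mutate_arrows k (add_arrows Q D) = add_arrows (mutate_arrows k Q) D.
Proof.
move=> qD z; apply/funext => x; apply/funext => y.
rewrite /mutate_arrows /add_arrows (zero_rowC x qD z) z !addr0.
case: ifP => [/orP[]/eqP <-|_]; last by ring.
  by rewrite z !addr0.
by rewrite (zero_rowC x qD z) !addr0.
Qed.

Lemma add_arrows_quiver Q D : is_quiver Q -> is_quiver D ->
  is_quiver (add_arrows Q D).
Proof. by move=> qQ qD x y; rewrite /add_arrows qQ qD opprD. Qed.

Lemma act_quiver s Q : is_quiver Q -> is_quiver (act s Q).
Proof. by move=> qQ; elim: s => //= k s; exact: mutate_is_quiver. Qed.

Lemma act_push s k Q : is_quiver Q -> act (push s k) Q = mutate_arrows k (act s Q).
Proof.
move=> qQ; case: s => //= a s; case: eqP => // ->.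
by rewrite mutate_arrowsK//; exact: act_quiver.
Qed.

Lemma zero_row_upto i m (Q : LF) x : zero_row Q x -> zero_row (mutate_upto i m Q) x.
Proof. by move=> z; elim: m => //= m; apply: zero_row_mutate; exact: LF_quiver. Qed.

Lemma nonzero_row_upto i m (Q : LF) x : ~ zero_row Q x ->
  ~ zero_row (mutate_upto i m Q) x.
Proof. by move=> z; elim: m => //= m; apply: nonzero_row_mutate; exact: LF_quiver. Qed.

Lemma mutate_upto_add i m (Q Q' : LF) D : is_quiver D ->
  (forall k, (k < m)%N -> zero_row D (i k)) ->
  (Q' : arrows) = add_arrows Q D ->
  (mutate_upto i m Q' : arrows) = add_arrows (mutate_upto i m Q) D.
Proof.
move=> qD + QD; elim: m => //= m IH zD.
by rewrite IH ?mutate_add// => [|k km]; apply: zD; rewrite // leqW.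
Qed.

(** The skipped vertices have zero rows at the start, hence at all times, and mutation at such a
    vertex is trivial. *)
Lemma mutate_upto_stack i K T m (Q : LF) : (T <= m)%N ->
  (forall k, (k < T)%N -> k \notin K) ->
  (forall k, (T <= k < m)%N -> k \in K \/ zero_row Q (i k)) ->
  (mutate_upto i m Q : arrows) = act (stack K i m) (mutate_upto i T Q).
Proof.
move=> + KT; elim: m => [|m IH].
  by rewrite leqn0 => /eqP ->.
rewrite leq_eqVlt => /predU1P[<- _|Tm KQ].
  by rewrite (@stack_const _ _ _ 0)// => k /andP[_ /KT].
have qm := LF_quiver (mutate_upto i m Q).
have [|Km] := boolP (m \in K).
  rewrite stackS /= => ->; rewrite act_push ?IH//; last exact: LF_quiver.
  by move=> k /andP[Tk km]; apply: KQ; rewrite Tk leqW.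
have [mK|z] := KQ m (introT andP (conj Tm (ltnSn m))).
  by rewrite mK in Km.
rewrite stackS (negPf Km) /= (mutate_zero_row qm (zero_row_upto i m z)) IH//.
by move=> k /andP[Tk km]; apply: KQ; rewrite Tk leqW.
Qed.

(** * Forks *)

Section MutateSigns.
Variables (Q : arrows) (k v w : posnat).
Hypotheses (kv : k != v) (kw : k != w).

Lemma mutate_pos : 0 < Q v k -> 0 < Q k w ->
  mutate_arrows k Q v w = Q v w + Q v k * Q k w.
Proof.
move=> vk0 kw0; rewrite /mutate_arrows (negPf kv) (negPf kw) /=.
by rewrite (pos_part_pos kw0) (pos_part_neg (a := - _)) ?mul0r ?addr0//; lia.
Qed.

Lemma mutate_neg : Q v k < 0 -> Q k w < 0 ->
  mutate_arrows k Q v w = Q v w - Q v k * Q k w.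
Proof.
move=> vk0 kw0; rewrite /mutate_arrows (negPf kv) (negPf kw) /=.
by rewrite (pos_part_neg (ltW kw0)) pos_part_pos ?mulr0 ?addr0 ?mulNr//; lia.
Qed.

Lemma mutate_pos_neg : 0 < Q v k -> Q k w < 0 -> mutate_arrows k Q v w = Q v w.
Proof.
move=> vk0 kw0; rewrite /mutate_arrows (negPf kv) (negPf kw) /=.
by rewrite (pos_part_neg (ltW kw0)) pos_part_neg ?mulr0 ?mul0r ?addr0//; lia.
Qed.

Lemma mutate_neg_pos : Q v k < 0 -> 0 < Q k w ->
  mutate_arrows k Q v w = Q v w.
Proof.
move=> vk0 kw0; rewrite /mutate_arrows (negPf kv) (negPf kw) /=.
by rewrite (pos_part_pos kw0) pos_part_pos; [ring|lia].
Qed.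

End MutateSigns.

(* Warkentin's forks, with point of return [r], on the full subquiver with
   vertex set [U]. *)
Definition fork (U : seq posnat) (r : posnat) (Q : arrows) : Prop :=
  [/\ r \in U,
      {in U &, forall p q, p != q -> 2 <= `|Q p q|},
      {in U & &, forall p q s, p != r -> q != r -> s != r ->
         0 < Q p q -> 0 < Q q s -> 0 < Q p s} &
      {in U &, forall p q, 0 < Q p r -> 0 < Q r q ->
         Q p r < Q q p /\ Q r q < Q q p}].

(** The vertices other than [k] split into those with arrows to [k] and those with arrows from [k].
    Arrows within a side do not change; those across all end up going from the first side to the
    second, with multiplicity exceeding that of the arrows at [k]. *)
Lemma fork_mutate U r k Q : is_quiver Q -> fork U r Q -> k \in U -> k != r ->
  fork U k (mutate_arrows k Q).
Proof.
move=> qQ [Ur ab tr rt] Uk kr.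
have neq p q : 0 < Q p q -> p != q.
  by move=> pq; apply/eqP => e; move: pq; rewrite e quiver_diag.
have dich p q : p \in U -> q \in U -> p != q -> 2 <= Q p q \/ 2 <= Q q p.
  by move=> Up Uq /ab; rewrite (qQ q p) => /(_ Up Uq); lia.
(* Away from [r], acyclicity gives [0 < Q j i]. If [i] or [j] is [r], arrows from [i] to [j] close a
   3-cycle through [r]; by [rt] they are fewer than those from [j] to [k] or from [k] to [i], and
   the product of two numbers at least 2 outweighs them. *)
have path_k i j : i \in U -> j \in U -> 0 < Q j k -> 0 < Q k i ->
    Q j k < Q j i + Q j k * Q k i /\ Q k i < Q j i + Q j k * Q k i.
  move=> Ui Uj jk ki.
  have jk2 : 2 <= Q j k.
    by case: (dich _ _ Uj Uk (neq _ _ jk)) => //; rewrite (qQ k j); lia.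
  have ki2 : 2 <= Q k i.
    by case: (dich _ _ Uk Ui (neq _ _ ki)) => //; rewrite (qQ i k); lia.
  have [ir|ir] := eqVneq i r.
    subst i; have jr : j != r.
      by apply/eqP => e; move: jk; rewrite e qQ; lia.
    case: (dich _ _ Uj Ur jr) => [|rj]; first by nia.
    have := rt k j Uk Uj ki; rewrite (qQ j r); nia.
  have [jr|jr] := eqVneq j r.
    subst j; case: (dich _ _ Ui Ur ir) => [ri|]; last by nia.
    have := rt i k Ui Uk; rewrite (qQ r i); nia.
  have := tr j k i Uj Uk Ui jr kr ir jk ki; nia.
have qQ' : is_quiver (mutate_arrows k Q) by exact: mutate_is_quiver.
have mk p : mutate_arrows k Q p k = - Q p k /\ mutate_arrows k Q k p = - Q k p.
  by rewrite /mutate_arrows eqxx orbT.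
have cross p q : p \in U -> q \in U -> 0 < Q p k -> 0 < Q k q ->
    Q p k < mutate_arrows k Q p q /\ Q k q < mutate_arrows k Q p q.
  move=> Up Uq pk kq; rewrite mutate_pos// ?(neq _ _ kq)//; first exact: path_k.
  by rewrite eq_sym neq.
have same_to p q : 0 < Q p k -> 0 < Q q k -> mutate_arrows k Q p q = Q p q.
  move=> pk qk; rewrite mutate_pos_neg// 1?eq_sym ?(neq _ _ pk) ?(neq _ _ qk)//.
  by rewrite qQ; lia.
have same_from p q : 0 < Q k p -> 0 < Q k q -> mutate_arrows k Q p q = Q p q.
  move=> kp kq; rewrite mutate_neg_pos ?(neq _ _ kp) ?(neq _ _ kq)//.
  by rewrite qQ; lia.
have side p : p \in U -> p != k -> 0 < Q p k \/ 0 < Q k p.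
  by move=> Up pk; case: (dich _ _ Up Uk pk); [left|right]; lia.
have Q'0 p q : mutate_arrows k Q p q = - mutate_arrows k Q q p by exact: qQ'.
(* A 3-cycle on one side of [k] would pass through [r], and its vertex before
   (or after) [r] would be on the other side. *)
have to_r u : u \in U -> 0 < Q u r -> 0 < Q r k -> 0 < Q k u.
  by move=> Uu ur rk; have [] := rt u k Uu Uk ur rk; lia.
have from_r v : v \in U -> 0 < Q k r -> 0 < Q r v -> 0 < Q v k.
  by move=> Uv kr' rv; have [] := rt k v Uk Uv kr' rv; lia.
have asym p q : 0 < Q p q -> 0 < Q q p -> False by rewrite (qQ q p); lia.
have asym' p q : 0 < mutate_arrows k Q p q -> 0 < mutate_arrows k Q q p -> False.
  by rewrite (Q'0 q p); lia.
have cross0 p q : p \in U -> q \in U -> 0 < Q p k -> 0 < Q k q ->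
    0 < mutate_arrows k Q p q.
  by move=> Up Uq pk kq; have [/(lt_trans pk)] := cross p q Up Uq pk kq.
have dich0 p q : p \in U -> q \in U -> p != q -> 0 < Q p q \/ 0 < Q q p.
  by move=> Up Uq pq; case: (dich p q Up Uq pq) => h; [left|right]; exact: lt_le_trans h.
split => //.
- move=> p q Up Uq pq.
  have [pk|pk] := eqVneq p k; first by subst p; rewrite (mk q).2 normrN ab.
  have [qk|qk] := eqVneq q k; first by subst q; rewrite (mk p).1 normrN ab.
  have aux u v : u \in U -> v \in U -> u != k -> 0 < Q u k -> 0 < Q k v ->
      2 <= `|mutate_arrows k Q u v|.
    move=> Uu Uv uk uk0 kv; have [h _] := cross u v Uu Uv uk0 kv.
    have := ab u k Uu Uk uk; 
    rewrite (gtr0_norm uk0) (gtr0_norm (lt_trans uk0 h)) => h2.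
    exact: le_trans h2 (ltW h).
  case: (side p Up pk) => [pk0|kp]; case: (side q Uq qk) => [qk0|kq].
  + by rewrite same_to// ab.
  + exact: aux.
  + by rewrite Q'0 normrN; exact: aux.
  + by rewrite same_from// ab.
- move=> p q s Up Uq Us pk qk sk pq qs.
  case: (side p Up pk) (side s Us sk) => [pk0|kp] [sk0|ks].
  + case: (side q Uq qk) => [qk0|kq]; last first.
      by case: (asym' q s qs); exact: cross0.
    move: pq qs; rewrite !same_to// => pq qs.
    have ps : p != s by apply/eqP => e; subst s; exact: (asym p q).
    case: (dich0 p s Up Us ps) => // sp.
    have [e|pr] := eqVneq p r.
      by subst p; case: (asym s k sk0); apply: to_r.
    have [e|qr] := eqVneq q r.
      by subst q; case: (asym p k pk0); apply: to_r.
    have [e|sr] := eqVneq s r.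
      by subst s; case: (asym q k qk0); apply: to_r.
    exact: tr pq qs.
  + exact: cross0.
  + case: (side q Uq qk) => [qk0|kq].
      by case: (asym' p q pq); exact: cross0.
    by case: (asym' q s qs); exact: cross0.
  + case: (side q Uq qk) => [qk0|kq].
      by case: (asym' p q pq); exact: cross0.
    move: pq qs; rewrite !same_from// => pq qs.
    have ps : p != s by apply/eqP => e; subst s; exact: (asym p q).
    case: (dich0 p s Up Us ps) => // sp.
    have [e|pr] := eqVneq p r.
      by subst p; case: (asym k q kq); apply: from_r.
    have [e|qr] := eqVneq q r.
      by subst q; case: (asym k s ks); apply: from_r.
    have [e|sr] := eqVneq s r.
      by subst s; case: (asym k p kp); apply: from_r.
    exact: tr pq qs.
- move=> i j Ui Uj; rewrite (mk i).1 (mk j).2 -!qQ => ki jk.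
  by have [] := cross j i Uj Ui jk ki; lia.
Qed.

(** In [P] the vertex [x] is not joined to [l]; mutation at [y] supplies these arrows, twice as many
    as between [x] and [y], hence more than on either other side of the 3-cycles through [y]. The
    sign [eps] is the direction of the arrows between [x] and [y]. *)
Lemma fork_first U y x l eps P : is_quiver P -> U = x :: y :: l -> uniq U ->
  eps = 1 \/ eps = -1 ->
  2 <= eps * P x y ->
  {in l, forall a, P x a = 0} ->
  {in l, forall a, P y a = 2 * eps} ->
  {in l &, forall a b, a != b -> 2 <= `|P a b|} ->
  {in l & &, forall a b c, 0 < P a b -> 0 < P b c -> 0 < P a c} ->
  fork U y (mutate_arrows y P).
Proof.
move=> qP UE uU heps xy xl yl ab tr.
move: uU; rewrite UE /= inE negb_or => /andP[/andP[nxy xnl] /andP[ynl ul]].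
have nyx : y != x by rewrite eq_sym.
have qP' : is_quiver (mutate_arrows y P) by exact: mutate_is_quiver.
have ny a : a \in l -> y != a by move=> al; apply: contraNneq ynl => ->.
have Pyx : mutate_arrows y P y x = P x y.
  by rewrite /mutate_arrows eqxx (qP y x) opprK.
have Pya a : a \in l -> mutate_arrows y P y a = - (2 * eps).
  by move=> al; rewrite /mutate_arrows eqxx yl.
have Pxa a : a \in l -> mutate_arrows y P x a = 2 * P x y.
  move=> al; have ya := yl a al.
  case: heps => e; move: xy ya; rewrite e => xy ya.
    by rewrite (mutate_pos nyx (ny a al)) ?ya ?(xl a al)//; lia.
  by rewrite (mutate_neg nyx (ny a al)) ?ya ?(xl a al)//; lia.
have Pab a b : a \in l -> b \in l -> mutate_arrows y P a b = P a b.
  move=> al bl; have ya := yl a al; have yb := yl b bl; have ay := qP a y.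
  case: heps => e; move: ya yb ay; rewrite e => ya yb ay.
    by rewrite mutate_neg_pos ?yb ?ny//; lia.
  by rewrite mutate_pos_neg ?yb ?ny//; lia.
have dich p q : mutate_arrows y P p q = - mutate_arrows y P q p by exact: qP'.
set P' := mutate_arrows y P in Pyx Pya Pxa Pab dich *.
have UP p : p \in x :: y :: l -> [\/ p = x, p = y | p \in l].
  rewrite !inE => /orP[/eqP->|/orP[/eqP->|pl]].
  - by constructor 1.
  - by constructor 2.
  - by constructor 3.
split.
- by rewrite !inE eqxx orbT.
- have aux p q : p \in x :: y :: l -> q \in x :: y :: l -> p != q ->
      2 <= `|P' p q| \/ 2 <= `|P' q p|.
    move=> /UP[->|->|pl] /UP[->|->|ql] pq; rewrite ?eqxx in pq; try by [].
    + by right; rewrite Pyx; lia.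
    + by left; rewrite Pxa//; lia.
    + by left; rewrite Pyx; lia.
    + by left; rewrite Pya//; lia.
    + by right; rewrite Pxa//; lia.
    + by right; rewrite Pya//; lia.
    + by left; rewrite Pab// ab.
  by move=> p q Up Uq pq; case: (aux p q Up Uq pq) => //; rewrite dich normrN.
- move=> p q s Up Uq Us py qy sy.
  have inl u : u \in x :: y :: l -> u != y -> u = x \/ u \in l.
    by move=> /UP[->|->|ul']; rewrite ?eqxx//; [left|right].
  have xx : P' x x = 0 by rewrite /P' quiver_diag.
  have ax a : a \in l -> P' a x = - (2 * P x y) by move=> al; rewrite dich Pxa.
  have opp (c : int) : 0 < c -> 0 < - c -> False by clear; lia.
  case: (inl p Up py) (inl q Uq qy) (inl s Us sy) => [->|pl] [->|ql] [->|sl].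
  + by rewrite xx.
  + by rewrite xx.
  + by rewrite Pxa// ax// => h /(opp _ h).
  + by rewrite !Pxa.
  + by rewrite xx.
  + by rewrite ax// Pxa// => h h'; case: (opp _ h').
  + by rewrite !ax.
  + by rewrite !Pab//; exact: tr.
- have yy : P' y y = 0 by rewrite /P' quiver_diag.
  move=> p q /UP[->|->|pl] /UP[->|->|ql]; rewrite ?yy //.
  + by rewrite (dich x y); lia.
  + by rewrite (dich x y) Pyx Pya// (dich q x) Pxa//; lia.
  + by rewrite (dich p y) Pyx Pya// Pxa//; lia.
  + by rewrite (dich p y) !Pya//; lia.
Qed.

(** In a reduced word each mutation is at a vertex other than the previous one, which is the current
    point of return. *)
Lemma fork_act U y s P : is_quiver P -> {subset s <= U} ->
  reduced (rcons s y) -> fork U y (mutate_arrows y P) ->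
  fork U (head y s) (act (rcons s y) P).
Proof.
move=> qP; elim: s => [//|a s IH] sU /= red fU.
have qa : is_quiver (act (rcons s y) P) by exact: act_quiver.
apply: (@fork_mutate _ (head y s)) => //.
- apply: IH => //; first by move=> b bs; apply: sU; rewrite inE bs orbT.
  exact: path_sorted red.
- by apply: sU; rewrite inE eqxx.
- by case: s red {IH sU qa} => [|b s] /= /andP[].
Qed.

(** * Convergence of rows *)

Definition agree (V : set posnat) (Q Q' : arrows) : Prop :=
  forall x y, V x -> Q x y = Q' x y.

(** By skew-symmetry the rows of [V] determine its columns. *)
Lemma overfillP V (Q Q' : LF) : overfill V Q = overfill V Q' <-> agree V Q Q'.
Proof.
split=> [e x y Vx|h].
  have := congr1 (fun f => f x y) e.
  by rewrite /overfill mem_set.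
apply/funext => x; apply/funext => y; rewrite /overfill.
case: ifP => // /orP[]/set_mem; first exact: h.
by move=> Vy; rewrite LF_quiver h// -LF_quiver.
Qed.

Lemma open_agree V (Q : LF) : finite_set V -> open [set Q' : LF | agree V Q' Q].
Proof.
move=> fV; exists [set [set Q' : LF | agree V Q' Q]]; last by rewrite bigcup_set1.
move=> _ ->; exists V, Q; split => //.
by apply/seteqP; split => Q' /overfillP.
Qed.

Lemma open_LF_agree (O : set LF) (Q : LF) : open O -> O Q ->
  exists2 V, finite_set V & forall Q' : LF, agree V Q' Q -> O Q'.
Proof.
move=> [D' D'b <-] [B D'B BQ]; have [V [P [fV BE]]] := D'b _ D'B.
exists V => // Q' a; exists B => //; move: BQ; rewrite /idfun BE /= => <-.
exact/overfillP.
Qed.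

Lemma dense_LFP (A : set LF) : dense A <->
  forall (Q : LF) V, finite_set V -> exists2 Q' : LF, agree V Q' Q & A Q'.
Proof.
split=> [dA Q V fV|h O [Q OQ] oO].
  have [||Q' [a AQ']] := dA [set Q' : LF | agree V Q' Q].
  - by exists Q.
  - exact: open_agree.
  - by exists Q'.
have [V fV VO] := open_LF_agree oO OQ.
by have [Q' a AQ'] := h Q V fV; exists Q'; split => //; exact: VO.
Qed.

Definition rows_stabilize (u : nat -> LF) : Prop :=
  forall x, exists N, forall n, (N <= n)%N ->
    forall y, LF_arrows (u n) x y = LF_arrows (u N) x y.

Lemma rows_stabilize_limit u : rows_stabilize u ->
  exists L : LF, forall x, exists N, forall n, (N <= n)%N ->
    forall y, LF_arrows (u n) x y = LF_arrows L x y.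
Proof.
move=> /choice[f hf].
have qL : is_quiver (fun x y => LF_arrows (u (f x)) x y).
  move=> x y; rewrite -(hf x (maxn (f x) (f y))) ?leq_maxl//.
  by rewrite -(hf y (maxn (f x) (f y))) ?leq_maxr// [LHS]LF_quiver.
have lL : locally_finite (fun x y => LF_arrows (u (f x)) x y).
  by move=> x; exact: (LF_finite (u (f x)) x).
exists (MkLF qL lL) => x; exists (f x) => n; exact: hf.
Qed.

Lemma cvg_LFP (u : nat -> LF) : cvg (u n @[n --> \oo]) <-> rows_stabilize u.
Proof.
split=> [/cvg_ex[L uL] x|/rows_stabilize_limit[L uL]].
  have /uL[N _ hN] : nbhs L [set Q' : LF | agree [set x] Q' L].
    by apply: open_nbhs_nbhs; split => //; apply: open_agree.
  by exists N => n Nn y; rewrite [LHS]hN ?[RHS]hN//=.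
apply/cvg_ex; exists L => A; rewrite nbhsE => -[B [oB BL] BA].
have [V fV VB] := open_LF_agree oB BL.
have [f hf] := choice uL.
have [s Vs] : exists s : seq posnat, V = [set` s] by exact/finite_seqP.
exists (\max_(x <- s) f x) => // n /= sn; apply/BA/VB => x y; rewrite Vs => xs.
by apply: hf; apply: leq_trans sn; apply: (@leq_bigmax_seq _ s xpredT f).
Qed.

Lemma converges_LFP i Q :
  converges_LF i Q <-> rows_stabilize (fun m => mutate_upto i m Q).
Proof.
rewrite /converges_LF /mkset cvg_LFP; split=> h x; have [N hN] := h x.
  by exists N.+1 => -[//|n] Nn y; exact: hN.
exists N => n Nn y; rewrite [LHS]hN ?[RHS]hN// leqW//.
Qed.

Lemma LF_row_finite (Q : LF) x : finite_set [set y | LF_arrows Q x y != 0].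
Proof.
apply: contrapT => infQ; have [M hM] := LF_finite Q x.
have [A AQ cA] := infinite_set_fset `|M|.+1 infQ.
have := hM A; apply/negP; rewrite -ltNge.
have : (#|` A|%:Z <= \sum_(y <- A) `|LF_arrows Q x y|).
  rewrite -[_%:Z]natz -sum1_size natr_sum big_seq [leRHS]big_seq.
  apply: ler_sum => y /AQ /=; lia.
by lia.
Qed.

Lemma finite_rows_locally_finite (Q : arrows) (f : posnat -> seq posnat) :
  (forall x y, Q x y != 0 -> y \in f x) -> locally_finite Q.
Proof.
move=> Qf x; exists (\sum_(z <- f x) `|Q x z|) => A.
have -> : \sum_(y <- A) `|Q x y| = \sum_(y <- A | y \in f x) `|Q x y|.
  rewrite [RHS]big_mkcond; apply: eq_bigr => y _.
  by case: ifPn => // yf; apply/eqP; rewrite normr_eq0; apply: contraNT yf => /Qf.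
rewrite -big_filter; set B := [seq y <- A | _].
have uB : uniq B by rewrite filter_uniq.
have : {subset B <= f x} by move=> y; rewrite mem_filter => /andP[].
elim: B (f x) uB => [|b B IH] l /=; first by rewrite big_nil sumr_ge0.
move=> /andP[bB uB] sBl; rewrite big_cons.
have bl : b \in l by apply: sBl; rewrite inE eqxx.
rewrite [leRHS](perm_big _ (perm_to_rem bl)) big_cons lerD2l; apply: IH => // y yB.
have : y \in b :: rem b l by rewrite -(perm_mem (perm_to_rem bl)) sBl// inE yB orbT.
by rewrite inE => /orP[/eqP yb|//]; rewrite yb (negPf bB) in yB.
Qed.

(** * Diverging quivers *)

Definition positions_in (i : nat -> posnat) (A : seq posnat) : set nat :=
  [set k | i k \in A].

Lemma stack_sub K (i : nat -> posnat) m v : v \in stack K i m ->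
  exists2 k, K k & v = i k.
Proof.
elim: m => //= m IH; case: ifPn => // /set_mem Km.
case: (stack K i m) IH => [_|a s IH] /=.
  by rewrite inE => /eqP ->; exists m.
case: ifP => _; first by move=> vs; apply: IH; rewrite inE vs orbT.
by rewrite inE => /orP[/eqP ->|/IH//]; exists m.
Qed.

Lemma finite_letters_bound (i : nat -> posnat) (s : seq posnat) (P : posnat -> Prop) :
  (forall v, v \in s -> P v -> finite_set [set k | i k = v]) ->
  exists N, forall k, i k \in s -> P (i k) -> (k < N)%N.
Proof.
elim: s => [|v s IH] h; first by exists 0%N.
have [|N hN] := IH; first by move=> w ws; apply: h; rewrite inE ws orbT.
have [Pv|nPv] := pselect (P v); last first.
  by exists N => k; rewrite inE => /orP[/eqP ->|/hN].
have [M hM] := finite_nat_bound (h v (mem_head _ _) Pv).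
exists (maxn N M) => k; rewrite inE => /orP[/eqP kv _|ks Pk].
  by rewrite (leq_trans (hM k kv))// leq_maxr.
by rewrite (leq_trans (hN k ks Pk))// leq_maxl.
Qed.

(* The bottom letter [y] of the stacks is eventually constant. The letters of
   [A] are those read before the last occurrence of [y], so that deleting the
   other letters does not affect the stacks up to that time, and later on
   nothing can pop [y]. *)
Lemma separating_letters (i : nat -> posnat) (E : seq posnat) :
  (forall v, v \notin E -> finite_set [set k | i k = v]) ->
  tends_infty (fun m => size (stack [set k | i k \notin E] i m)) ->
  exists (A : seq posnat) y, [/\ y \in A, {in A, forall a, a \notin E} &
    exists N, forall m, (N <= m)%N ->
      i m \notin A /\ exists s, stack (positions_in i A) i m = rcons s y].
Proof.
set K := [set k | i k \notin E] => fE tinf.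
pose P N := `[< forall m, (N <= m)%N -> (1 <= size (stack K i m))%N >].
have /ex_minnP[N /asboolP hN minN] : exists N, P N.
  by have [N hN] := tinf 1%N; exists N; apply/asboolP.
(* The least such time is a successor because the stack starts empty; its predecessor, again called
   [N], is the last time at which the stack is empty. *)
case: N hN minN => [/(_ 0%N isT)//|N hN minN].
have e0 : stack K i N = [::].
  apply: contrapT => /eqP ne; have /minN : P N; last by rewrite ltnn.
  apply/asboolP => m; rewrite leq_eqVlt => /predU1P[<-|/hN//].
  by rewrite lt0n size_eq0.
have NK : N \in K.
  by have := hN N.+1 (leqnn _); rewrite stackS e0; case: (_ \in _).
set y := i N; have yE : y \notin E := set_mem NK.
have bot m : (N < m)%N -> exists s, stack K i m = rcons s y.
  elim: m => // m IH; rewrite ltnS leq_eqVlt => /predU1P[<-|Nm].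
    by rewrite stackS NK e0; exists [::].
  have [s e] := IH Nm; have := hN m.+1 (leqW Nm).
  rewrite stackS e; case: ifP => _; last by exists s.
  case: s {e} => [|a s] /=; last by case: ifP => _; [exists s|exists (i m :: a :: s)].
  by case: ifP => // _ _; exists [:: i m].
have [N0 hN0] := finite_nat_bound (fE y yE).
have NN0 : (N < N0)%N by exact: hN0.
pose A := [seq v <- mkseq i N0 | v \notin E].
have AE : {in A, forall a, a \notin E} by move=> a; rewrite mem_filter => /andP[].
have memA k : (k < N0)%N -> (i k \in A) = (i k \notin E).
  move=> kN; rewrite mem_filter; case: (_ \notin _) => //=.
  by apply/mapP; exists k; rewrite // mem_iota.
have botA m : (N0 <= m)%N -> exists s, stack (positions_in i A) i m = rcons s y.
  elim: m => [|m IH]; first by rewrite leqn0 => /eqP N00; rewrite N00 in NN0.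
  rewrite leq_eqVlt => /predU1P[<-|].
    rewrite (@eq_stack _ _ K) => [|k kN]; first exact: bot.
    by apply/idP/idP; rewrite !inE /positions_in /= memA.
  rewrite ltnS => mN; have [s e] := IH mN.
  rewrite stackS e; case: ifP => _; last by exists s.
  by apply: push_rcons; apply/eqP => /hN0; rewrite ltnNge mN.
exists A, y; split => //; first by rewrite memA.
have [N1 hN1] : exists N1, forall k, i k \in A -> True -> (k < N1)%N.
  by apply: (@finite_letters_bound i A (fun=> True)) => v /AE /fE.
exists (maxn N0 N1) => m; rewrite geq_max => /andP[N0m N1m]; split; last exact: botA.
by apply/negP => /hN1 /(_ I); rewrite ltnNge N1m.
Qed.

(** * Double arrows along a linear order, and isolated edges *)

Definition tournament (eps : int) (s : seq posnat) : arrows := fun u v =>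
  if (u \in s) && (v \in s) then
    if (index u s < index v s)%N then 2 * eps else
    if (index v s < index u s)%N then - (2 * eps) else 0
  else 0.

Lemma tournament_quiver eps s : is_quiver (tournament eps s).
Proof.
move=> u v; rewrite /tournament andbC; case: ifP => _; last by rewrite oppr0.
by case: ltngtP; rewrite ?opprK ?oppr0.
Qed.

Lemma tournament_zero eps s u : u \notin s -> zero_row (tournament eps s) u.
Proof. by move=> us v; rewrite /tournament (negPf us). Qed.

Lemma tournament_locally_finite eps s : locally_finite (tournament eps s).
Proof.
apply: (@finite_rows_locally_finite _ (fun=> s)) => u v.
by rewrite /tournament; case: andP => // -[].
Qed.

Lemma tournament_norm eps s : (eps = 1 \/ eps = -1) ->
  {in s &, forall u v, u != v -> 2 <= `|tournament eps s u v|}.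
Proof.
move=> he u v us vs uv; rewrite /tournament us vs /=.
case: (ltngtP (index u s) (index v s)) => [_|_|e].
- by case: he => ->.
- by case: he => ->.
- by case/eqP: uv; rewrite -(nth_index u us) e nth_index.
Qed.

Lemma tournament_trans eps s : (eps = 1 \/ eps = -1) ->
  {in s & &, forall u v w, 0 < tournament eps s u v ->
     0 < tournament eps s v w -> 0 < tournament eps s u w}.
Proof.
move=> he u v w us vs ws; rewrite /tournament us vs ws /=.
move: (index u s) (index v s) (index w s) => a b c.
case: he => ->; case: (ssrnat.ltngtP a b) => // ab; case: (ssrnat.ltngtP b c) => // bc _ _.
  by rewrite (ltn_trans ab bc).
by rewrite (ltn_trans bc ab) ltnNge ltnW// (ltn_trans bc ab).
Qed.

(** Mutation at either end reverses the edge and elsewhere leaves it alone. This keeps [x] joined to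
    the first vertex [y], whatever is read meanwhile. *)
Lemma mutate_isolated_edge k Q x y : is_quiver Q -> x != y ->
  (forall w, w != y -> Q x w = 0) -> (forall w, w != x -> Q y w = 0) ->
  let Q' := mutate_arrows k Q in
  [/\ forall w, w != y -> Q' x w = 0, forall w, w != x -> Q' y w = 0 &
      `|Q' x y| = `|Q x y|].
Proof.
move=> qQ xy.
have aux a b : a != b -> (forall w, w != b -> Q a w = 0) ->
    (forall w, w != a -> Q b w = 0) ->
    (forall w, w != b -> mutate_arrows k Q a w = 0) /\
    `|mutate_arrows k Q a b| = `|Q a b|.
  move=> ab ha hb.
  have [->|ka] := eqVneq k a.
    rewrite /mutate_arrows eqxx /= normrN; split => // w wb.
    by rewrite ha// oppr0.
  have [->|kb] := eqVneq k b.
    rewrite /mutate_arrows eqxx orbT normrN; split => // w wb.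
    rewrite eq_sym (negPf ab) [b == w]eq_sym (negPf wb) /= ha//.
    have [->|wa] := eqVneq w a.
      rewrite (qQ b a); move: (Q a b) => c.
      by rewrite /pos_part; lia.
    by rewrite hb// /pos_part mulr0 addr0 mulr0.
  rewrite (mutate_row b ka (ha k kb) qQ); split => // w wb.
  by rewrite (mutate_row w ka (ha k kb) qQ) ha.
move=> hx hy /=; have [? ?] := aux x y xy hx hy.
by have [] := aux y x _ hy hx; rewrite 1?eq_sym.
Qed.

Lemma isolated_edge_upto i m (Q : LF) x y : x != y ->
  (forall w, w != y -> LF_arrows Q x w = 0) ->
  (forall w, w != x -> LF_arrows Q y w = 0) ->
  `|LF_arrows (mutate_upto i m Q) x y| = `|LF_arrows Q x y|.
Proof.
move=> xy hx hy.
suff [_ _] : [/\ forall w, w != y -> LF_arrows (mutate_upto i m Q) x w = 0,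
    forall w, w != x -> LF_arrows (mutate_upto i m Q) y w = 0 &
    `|LF_arrows (mutate_upto i m Q) x y| = `|LF_arrows Q x y|] by [].
elim: m => [//|m [IHx IHy <-]].
exact: (mutate_isolated_edge (i m) (LF_quiver (mutate_upto i m Q)) xy IHx IHy).
Qed.

Lemma add_LF (Q : LF) D : is_quiver D -> locally_finite D ->
  exists Q' : LF, LF_arrows Q' = add_arrows Q D.
Proof.
move=> qD lD; have qQD := add_arrows_quiver (LF_quiver Q) qD.
have lQD : locally_finite (add_arrows Q D).
  move=> x; have [M hM] := LF_finite Q x; have [N hN] := lD x.
  exists (M + N) => A; apply: le_trans (lerD (hM A) (hN A)).
  by rewrite -big_split; apply: ler_sum => y _; exact: ler_normD.
by exists (MkLF qQD lQD).
Qed.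

(* A stage of the construction of a quiver on which the sequence diverges: the
   quiver [sQ] built so far; the vertices [sW] whose rows are final, among them
   the letters already read; the time [sT] at which [x] is joined to [sy]; and
   the letters [sA], still unread, whose mutations will join [x] to the next
   vertex. *)
Record stage := Stage {
  sQ : LF; sW : seq posnat; sT : nat; sA : seq posnat; sy : posnat }.

(** By [ok_after] and [ok_support], letters read from time [sT] on meet zero rows unless they equal
    [sy]; so, once arrows are added on [sA], only the letters of [sA] act, and by [ok_stack] they
    leave a reduced word with first letter [sy]. *)
Record stage_ok (i : nat -> posnat) (x : posnat) (S : stage) : Prop := {
  ok_x : x \in sW S;
  ok_y : sy S \in sA S;
  ok_fresh : {in sA S, forall a, a \notin sW S};
  ok_finite : forall v, v \notin sW S -> finite_set [set k | i k = v];
  ok_support : forall u, u \notin sW S -> u != sy S -> zero_row (sQ S) u;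
  ok_before : forall k, (k < sT S)%N -> i k \in sW S;
  ok_after : forall k, (sT S <= k)%N -> i k \in sW S -> zero_row (sQ S) (i k);
  ok_stack : exists N, forall m, (N <= m)%N ->
    i m \notin sA S /\ exists s, stack (positions_in i (sA S)) i m = rcons s (sy S);
  ok_joined : 2 <= `|LF_arrows (mutate_upto i (sT S) (sQ S)) x (sy S)| }.

Record extends (S S' : stage) : Prop := {
  ext_W : {subset sW S <= sW S'};
  ext_A : {subset sA S <= sW S'};
  ext_T : (sT S < sT S')%N;
  ext_Q : agree [set` sW S] (sQ S') (sQ S) }.

Definition escapes (i : nat -> posnat) (W : seq posnat) : Prop :=
  tends_infty (fun m => size (stack [set k | i k \notin W] i m)).

Lemma stage_step i x S : (forall W, {subset sW S <= W} -> escapes i W) ->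
  stage_ok i x S -> exists2 S', stage_ok i x S' & extends S S'.
Proof.
case: S => Q W T A y /= esc [/= xW yA AW finW supp before after [N hN] joined].
(* At time [T'] the letters of [A] are exhausted; putting them and all letters read so far in [W']
   makes the next choice of letters disjoint from them. *)
pose T' := maxn N T.+1; pose W' := W ++ A ++ mkseq i T'.
have TT' : (T < T')%N by rewrite leq_maxr.
have WW' : {subset W <= W'} by move=> w; rewrite mem_cat => ->.
have AW' : {subset A <= W'} by move=> w; rewrite !mem_cat => ->; rewrite orbT.
have iW' k : (k < T')%N -> i k \in W'.
  by move=> kT; rewrite !mem_cat map_f ?orbT// mem_iota.
have finW' v : v \notin W' -> finite_set [set k | i k = v].
  by move=> vW'; apply: finW; apply: contra vW' => /WW'.
have [A' [y' [yA' AW'' [N' hN']]]] := separating_letters finW' (esc W' WW').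
have y'W' : y' \notin W' by exact: AW''.
have y'W : y' \notin W by apply: contra y'W' => /WW'.
have y'A : y' \notin A by apply: contra y'W' => /AW'.
(* In the order of [y :: l] the letters of [A] other than [y] lie between the extremes [y] and
   [y']. *)
pose l := rcons (rem y (undup A)) y'.
have lE a : a \in l -> a = y' \/ a \in A /\ a != y.
  rewrite mem_rcons inE => /orP[/eqP|]; first by left.
  by rewrite mem_rem_uniq ?undup_uniq// inE mem_undup => /andP[]; right.
have lW a : a \in l -> a \notin W by move=> /lE[->//|[/AW]].
have ly a : a \in l -> a != y.
  by move=> /lE[->|[]//]; apply: contraNneq y'A => ->.
have syl a : a \in y :: l -> a \in A \/ a = y'.
  by rewrite inE => /orP[/eqP ->|/lE[->|[]]]; [left|right|left].
have sW0 a : a \in y :: l -> a \notin W.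
  by move=> /syl[/AW|->].
set Qt := mutate_upto i T Q in joined.
pose c := LF_arrows Qt x y.
pose eps : int := if 0 <= c then 1 else -1.
have heps : eps = 1 \/ eps = -1 by rewrite /eps; case: ifP => _; [left|right].
pose D := tournament eps (y :: l).
have qD : is_quiver D by exact: tournament_quiver.
have [Q' Q'E] := add_LF Q qD (@tournament_locally_finite eps (y :: l)).
have DW u : u \in W -> zero_row D u.
  by move=> uW; apply: tournament_zero; apply: contraL uW => /sW0.
have Q't : LF_arrows (mutate_upto i T Q') = add_arrows Qt D.
  by apply: mutate_upto_add => // k kT; exact/DW/before.
have zero_after k : (T <= k)%N -> i k \notin A -> i k \in W' -> zero_row Q' (i k).
  move=> Tk ikA ikW' v; rewrite Q'E /add_arrows.
  have -> : D (i k) v = 0.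
    apply: tournament_zero; apply/negP => /syl[]; first by apply/negP.
    by move=> e; rewrite e (negPf y'W') in ikW'.
  rewrite addr0; have [ikW|ikW] := boolP (i k \in W); first exact: after.
  by apply: supp => //; apply: contraNneq ikA => ->.
have Q't' : LF_arrows (mutate_upto i T' Q') =
    act (stack (positions_in i A) i T') (add_arrows Qt D).
  rewrite -Q't; apply: mutate_upto_stack; first exact: ltnW.
    move=> k kT; apply/negP; rewrite inE /positions_in /= => /AW.
    by rewrite before.
  move=> k /andP[Tk kT']; have [ikA|ikA] := boolP (i k \in A).
    by left; rewrite inE.
  by right; apply: zero_after => //; exact: iW'.
have [_ [s sE]] := hN T' (leq_maxl _ _).
have xl : x \notin y :: l by apply: contraL xW => /sW0.
have ul : uniq (x :: y :: l).
  rewrite /= xl /= rcons_uniq rem_uniq ?undup_uniq// andbT.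
  apply/andP; split; first by apply/negP => /ly; rewrite eqxx.
  by apply: contra y'A => /mem_rem; rewrite mem_undup.
pose P := add_arrows Qt D.
have qP : is_quiver P by apply: add_arrows_quiver => //; exact: LF_quiver.
have Qt0 a : a \in l -> zero_row Qt a.
  by move=> al; apply: zero_row_upto; apply: supp; [exact: lW|exact: ly].
have Dx v : D x v = 0 by exact: tournament_zero.
have PD a b : a \in l -> P a b = D a b.
  by move=> al; rewrite /P /add_arrows Qt0// add0r.
have Pc : P x y = c by rewrite /P /add_arrows Dx addr0.
have lin a : a \in l -> a \in y :: l by move=> al; rewrite inE al orbT.
have frk : fork (x :: y :: l) y (mutate_arrows y P).
  apply: (@fork_first _ y x l eps) => //.
  - rewrite Pc; move: joined; rewrite -/c /eps; case: (leP 0 c) => c0.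
      by rewrite mul1r ger0_norm.
    by rewrite mulN1r ltr0_norm.
  - move=> a al; rewrite /P /add_arrows Dx addr0.
    by apply: zero_rowC; [exact: LF_quiver|exact: Qt0].
  - move=> a al; rewrite qP PD// -qD /D /tournament mem_head lin//= eqxx.
    by rewrite eq_sym (negPf (ly a al)).
  - by move=> a b al bl ab; rewrite PD// tournament_norm// lin.
  - move=> a b d al bl dl; rewrite !PD//.
    by apply: tournament_trans => //; exact: lin.
have sA a : a \in rcons s y -> a \in A.
  by rewrite -sE => /stack_sub[k + ->].
have {}frk : fork (x :: y :: l) (head y s) (LF_arrows (mutate_upto i T' Q')).
  rewrite Q't' sE; apply: fork_act => //; last by rewrite -sE stack_reduced.
  move=> a as_; have aA : a \in A by apply: sA; rewrite mem_rcons inE as_ orbT.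
  rewrite !inE mem_rcons inE mem_rem_uniq ?undup_uniq// inE mem_undup aA andbT.
  by case: (a == y); rewrite /= !orbT.
have y'l : y' \in l by rewrite mem_rcons mem_head.
have joined' : 2 <= `|LF_arrows (mutate_upto i T' Q') x y'|.
  case: frk => _ + _ _; apply; rewrite ?mem_head ?inE ?y'l ?orbT//.
  by apply: contraNneq xl => ->; exact: lin.
exists (Stage Q' W' T' A' y'); split => //=.
- exact: WW'.
- move=> u uW' uy' v; rewrite Q'E /add_arrows.
  rewrite [X in _ + X]tournament_zero; last first.
    by apply/negP => /syl[/AW' uA|/eqP]; [rewrite uA in uW'|apply/negP].
  rewrite addr0; apply: supp; first by apply: contra uW' => /WW'.
  by apply: contraNneq uW' => ->; exact: AW'.
- move=> k T'k ikW'; apply: zero_after => //; first by rewrite (leq_trans _ T'k)// ltnW.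
  by have [] := hN k (leq_trans (leq_maxl _ _) T'k).
- by exists N'.
- by move=> u v /= uW; rewrite Q'E /add_arrows DW// addr0.
Qed.

(** Rows in some [sW] become final, which gives the limit [L]. At time [sT (st N)] row [x] of the
    mutated [L] vanishes at [sy (st N.+1)], while at time [sT (st N.+1)] that entry has absolute
    value at least 2. *)
Lemma stage_chain_diverges i x (st : nat -> stage) :
  (forall n, stage_ok i x (st n)) -> (forall n, extends (st n) (st n.+1)) ->
  exists2 L : LF, diverges_LF i L & agree [set` sW (st 0%N)] L (sQ (st 0%N)).
Proof.
move=> ok ext.
have Wmono n m u : (n <= m)%N -> u \in sW (st n) -> u \in sW (st m).
  elim: m => [|m IH]; first by rewrite leqn0 => /eqP ->.
  rewrite leq_eqVlt => /predU1P[-> //|nm] un.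
  exact/(ext_W (ext m))/IH.
have agr n m : (n <= m)%N -> agree [set` sW (st n)] (sQ (st m)) (sQ (st n)).
  elim: m => [|m IH]; first by rewrite leqn0 => /eqP ->.
  rewrite leq_eqVlt => /predU1P[<- //|nm] u v un.
  by rewrite (ext_Q (ext m)) ?IH//=; exact: Wmono un.
have [|L hL] := @rows_stabilize_limit (fun n => sQ (st n)).
  move=> u; have [[n un]|/forallNP nW] := pselect (exists n, u \in sW (st n)).
    by exists n => m nm v; exact: agr.
  have z n : zero_row (sQ (st n)) u.
    apply: (ok_support (ok n)); first exact/negP.
    apply/eqP => e; apply: (nW n.+1); apply: (ext_A (ext n)).
    by rewrite e; exact: ok_y (ok n).
  by exists 0%N => n _ v; rewrite !z.
have Lagr n : agree [set` sW (st n)] L (sQ (st n)).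
  move=> u v un; have [N hN] := hL u.
  by rewrite -(hN (maxn N n)) ?leq_maxl// (agr n)// leq_maxr.
exists L; last exact: Lagr.
have Lt n v : v \notin sW (st n) ->
    LF_arrows (mutate_upto i (sT (st n)) L) x v =
    LF_arrows (mutate_upto i (sT (st n)) (sQ (st n))) x v.
  (* The difference [R] has zero rows at all letters read before [sT (st n)], so these mutations
     carry it along unchanged. *)
  move=> vn; pose R : arrows := fun u v => LF_arrows L u v - LF_arrows (sQ (st n)) u v.
  have R0 u : u \in sW (st n) -> zero_row R u.
    by move=> un w; rewrite /R (Lagr n)// subrr.
  rewrite (@mutate_upto_add i _ (sQ (st n)) L R).
  - by rewrite /add_arrows R0 ?addr0//; exact: ok_x (ok n).
  - by move=> u w; rewrite /R LF_quiver [X in _ - X]LF_quiver opprB opprK addrC.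
  - by move=> k kT; apply/R0/(ok_before (ok n)).
  - apply/funext => u; apply/funext => w; rewrite /add_arrows /R addrC subrK//.
have y_new n : sy (st n) \notin sW (st n).
  exact/(ok_fresh (ok n))/(ok_y (ok n)).
move=> /converges_LFP/(_ x)[N hN].
have T_ge n : (n <= sT (st n))%N.
  by elim: n => // n IH; exact: leq_ltn_trans IH (ext_T (ext n)).
have yW : sy (st N.+1) \notin sW (st N).
  by apply: contra (y_new N.+1) => /(ext_W (ext N)).
have e1 := Lt N _ yW; have e2 := Lt N.+1 _ (y_new N.+1).
have := ok_joined (ok N.+1).
rewrite -e2 hN ?(leq_trans (leqnSn N))// -(hN (sT (st N)))// e1 zero_rowC//.
  exact: LF_quiver.
apply: zero_row_upto; apply: (ok_support (ok N)) => //.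
apply: contraNneq (y_new N.+1) => ->; apply: (ext_A (ext N)).
exact: ok_y (ok N).
Qed.

Lemma posnat_fresh (s : seq posnat) : exists x : posnat, x \notin s.
Proof.
pose x : posnat := exist _ (\max_(z <- s) val z).+1 isT.
exists x; apply/negP => xs.
by have := @leq_bigmax_seq _ s xpredT val x xs isT; rewrite ltnn.
Qed.

(** The chain of stages starts from [Q] with an isolated double arrow added between a fresh [x] and
    the first letter [y] given by [separating_letters]. *)
Lemma escaping_diverges i (F : seq posnat) (Q : LF) :
  (forall v, v \notin F -> finite_set [set k | i k = v]) ->
  (forall W, {subset F <= W} -> escapes i W) ->
  (forall u, u \notin F -> zero_row Q u) ->
  (forall u, infinite_values i u -> zero_row Q u) ->
  exists2 L : LF, diverges_LF i L & agree [set` F] L Q.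
Proof.
move=> finF esc suppF zinf.
have [x xF] := posnat_fresh F.
have [T hT] : exists T, forall k, i k \in x :: F ->
    ~ infinite_values i (i k) -> (k < T)%N.
  apply: (@finite_letters_bound i (x :: F) (fun v => ~ infinite_values i v)) => v _.
  exact: contrapT.
pose W := x :: F ++ mkseq i T.
have FW : {subset F <= W} by move=> v vF; rewrite inE mem_cat vF orbT.
have finW v : v \notin W -> finite_set [set k | i k = v].
  by move=> vW; apply: finF; apply: contra vW => /FW.
have [A [y [yA AW [N hN]]]] := separating_letters finW (esc W FW).
have yW : y \notin W by exact: AW.
have xy : x != y by apply: contraNneq yW => <-; rewrite mem_head.
pose D := tournament 1 [:: x; y].
have qD : is_quiver D by exact: tournament_quiver.
have [Q' Q'E] := add_LF Q qD (@tournament_locally_finite 1 [:: x; y]).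
have DE u : u != x -> u != y -> zero_row D u.
  by move=> ux uy; apply: tournament_zero; rewrite !inE negb_or ux.
have Fx u : u \in F -> u != x by apply: contraTneq => ->.
have Fy u : u \in F -> u != y.
  by apply: contraTneq => ->; apply: contra yW => /FW.
have yF : y \notin F by apply: contra yW => /FW.
have Dxw w : w != y -> D x w = 0.
  move=> wy; have [->|wx] := eqVneq w x; first exact: quiver_diag.
  by apply: zero_rowC => //; exact: DE.
have Dyw w : w != x -> D y w = 0.
  move=> wx; have [->|wy] := eqVneq w y; first exact: quiver_diag.
  by apply: zero_rowC => //; exact: DE.
have Dxy : D x y = 2.
  by rewrite /D /tournament !inE /= !eqxx orbT (negPf xy).
have ok0 : stage_ok i x (Stage Q' W T A y).
  split => //=.
  - exact: mem_head.
  - move=> u uW uy v; rewrite Q'E /add_arrows.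
    rewrite suppF ?add0r; last by apply: contra uW => /FW.
    by apply: DE => //; apply: contraNneq uW => ->; rewrite mem_head.
  - by move=> k kT; rewrite inE mem_cat [_ \in mkseq _ _]map_f ?orbT// mem_iota.
  - move=> k Tk ikW v; rewrite Q'E /add_arrows.
    have iky : i k != y by apply: contraTneq ikW => ->.
    have [ikxF|] := boolP (i k \in x :: F).
      have [ik|nik] := pselect (infinite_values i (i k)); last first.
        by have := hT k ikxF nik; rewrite ltnNge Tk.
      rewrite zinf// add0r; apply: DE => //.
      by apply/eqP => e; apply: ik; rewrite e; exact: finF.
    rewrite inE negb_or => /andP[ikx ikF].
    by rewrite suppF// add0r; exact: DE.
  - by exists N.
  - rewrite isolated_edge_upto//.
    + by rewrite Q'E /add_arrows suppF// Dxy.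
    + by move=> w wy; rewrite Q'E /add_arrows suppF// Dxw.
    + by move=> w wx; rewrite Q'E /add_arrows suppF// Dyw.
have escW S : {subset F <= sW S} -> forall W', {subset sW S <= W'} -> escapes i W'.
  by move=> FS W' SW'; apply: esc => v /FS/SW'.
pose good := {S | stage_ok i x S /\ {subset F <= sW S}}.
have /choice[f hf] : forall S : good, exists S' : good, extends (sval S) (sval S').
  move=> [S [okS FS]]; have [S' okS' e] := stage_step (escW S FS) okS.
  have FS' : {subset F <= sW S'} by move=> v /FS/(ext_W e).
  by exists (exist _ S' (conj okS' FS')).
pose st n : good := iter n f (exist _ _ (conj ok0 FW)).
have [||L dL aL] := @stage_chain_diverges i x (fun n => sval (st n)).
- by move=> n; case: (svalP (st n)).
- by move=> n; exact: hf.
exists L => // u v uF; rewrite aL/=; last exact: (FW u uF).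
by rewrite Q'E /add_arrows DE ?addr0//; [exact: Fx|exact: Fy].
Qed.

(** * Dichotomies *)

Definition finite_letters (i : nat -> posnat) : posseq :=
  restrict_values (~` infinite_values i) (posseq_of i).

Lemma finite_letters_mult i : finite_mult (finite_letters i).
Proof.
move=> v; have [iv|/contrapT] := pselect (infinite_values i v); last first.
  by apply: sub_finite_set => k [].
apply: (@sub_finite_set _ _ set0) => // k [[_ +] e]; apply.
by rewrite /= in e *; rewrite e.
Qed.

Lemma finite_lettersT i : infinite_values i = set0 ->
  finite_letters i = posseq_of i.
Proof.
by move=> e; rewrite /finite_letters e setC0 /restrict_values preimage_setT setTI.
Qed.

(** The letters of [W] with finitely many occurrences run out, so from some time on both stacks read
    the same positions. *)
Lemma finite_letters_escape i W :
  infinite_length (reduction (finite_letters i)) ->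
  (forall v, infinite_values i v -> v \in W) -> escapes i W.
Proof.
move=> il IW; have t := infinite_length_reduction (@finite_letters_mult i) il.
have [N hN] : exists N, forall k, i k \in W -> ~ infinite_values i (i k) -> (k < N)%N.
  apply: (@finite_letters_bound i W (fun v => ~ infinite_values i v)) => v _.
  exact: contrapT.
apply: (@tends_infty_stack_restrict _ _ _ i N _ t) => k Nk.
apply/idP/idP => /set_mem h; apply/mem_set.
  apply/negP => /hN; case: h => _ h /(_ h); by rewrite ltnNge Nk.
by split => // iv; move: h => /=; rewrite IW.
Qed.

(** Each mutation at [x] negates row [x], which never becomes zero, so late readings of [x] keep
    changing it. *)
Lemma recurrent_nonzero_diverges i (Q : LF) x : infinite_values i x ->
  ~ zero_row Q x -> diverges_LF i Q.
Proof.
move=> ix nz /converges_LFP/(_ x)[N hN].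
have [k /= kx Nk] := infinite_nat_beyond N ix.
apply: (nonzero_row_upto (i := i) (m := k) nz) => y.
have := hN k.+1 (leqW Nk) y; rewrite -(hN k Nk) /= /mutate_arrows kx eqxx /=.
by move: (LF_arrows _ _ _) => c; lia.
Qed.

(* Whenever the stack comes back to [t], so does the quiver [act t Q]; after the
   last mutations at [x] and at its neighbours in [act t Q], row [x] is frozen. *)
Lemma returning_converges i (Q : LF) :
  (forall u, infinite_values i u -> zero_row Q u) ->
  finite_length (reduction (finite_letters i)) -> converges_LF i Q.
Proof.
move=> zQ /(finite_length_reduction (@finite_letters_mult i)).
move=> /stack_bounded_repeats[t [_ [rep _]]]; apply/converges_LFP => x.
have actE m : LF_arrows (mutate_upto i m Q) =
    act (stack (positions (finite_letters i)) i m) Q.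
  rewrite (@mutate_upto_stack i (positions (finite_letters i)) 0)// => k _.
  have [iv|niv] := pselect (infinite_values i (i k)); first by right; exact: zQ.
  by left; apply/mem_set.
have [ix|nix] := pselect (infinite_values i x).
  by exists 0%N => n _ y; rewrite !(zero_row_upto i _ (zQ _ ix)).
have [m1 _ e1] := rep 0%N.
have /finite_seqP[f fE] := LF_row_finite (mutate_upto i m1 Q) x.
have [N hN] : exists N, forall k, i k \in x :: f ->
    ~ infinite_values i (i k) -> (k < N)%N.
  apply: (@finite_letters_bound i (x :: f) (fun v => ~ infinite_values i v)) => v _.
  exact: contrapT.
have [m0 Nm0 e0] := rep N.
have Q0 : LF_arrows (mutate_upto i m0 Q) = LF_arrows (mutate_upto i m1 Q).
  by rewrite !actE e0 -e1.
exists m0; elim=> [|m IH]; first by rewrite leqn0 => /eqP ->.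
rewrite leq_eqVlt => /predU1P[-> //|m0m] y; rewrite -(IH m0m) /=.
have nN : ~ (m < N)%N by apply/negP; rewrite -leqNgt (leq_trans Nm0).
apply: mutate_row; last exact: LF_quiver.
  apply/eqP => e; apply/nN/hN; rewrite e//; exact: mem_head.
apply/eqP; apply: contrapT => /negP nz; apply/nN/hN.
  rewrite inE; apply/orP; right; rewrite (IH m0m) Q0 in nz.
  by have : [set` f] (i m) by rewrite -fE.
(* A letter read infinitely often has a zero row and is therefore no neighbour of [x]. *)
move=> iv; move/negP: nz; apply; apply/eqP.
by apply: zero_rowC; [exact: LF_quiver|exact/zero_row_upto/zQ].
Qed.

(** * Finitely supported approximations and density *)

Lemma finite_truncation (Q : LF) V : finite_set V ->
  exists (Q0 : LF) (F : seq posnat),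
    [/\ agree V Q0 Q, forall u, V u -> u \in F,
        forall u, u \notin F -> zero_row Q0 u &
        forall u, zero_row Q u -> zero_row Q0 u].
Proof.
move=> fV; have qQ := LF_quiver Q.
have qV : is_quiver (overfill V Q).
  by move=> x y; rewrite /overfill orbC; case: ifP => _; rewrite ?oppr0 1?qQ.
have lV : locally_finite (overfill V Q).
  move=> x; have [M hM] := LF_finite Q x; exists M => A; apply: le_trans (hM A).
  by apply: ler_sum => y _; rewrite /overfill; case: ifP; rewrite ?normr0.
(* The arrows of [overfill V Q] lie among [V] and its neighbours, finitely many by local
   finiteness. *)
have /finite_seqP[F FE] :
    finite_set (V `|` \bigcup_(v in V) [set y | LF_arrows Q v y != 0]).
  by rewrite finite_setU; split => //; apply: bigcup_finite => // v _;
    exact: LF_row_finite.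
have VF u : V u -> u \in F.
  by move=> Vu; have : [set` F] u by rewrite -FE; left.
exists (MkLF qV lV), F; split => //=.
- by move=> x y Vx; rewrite /= /overfill mem_set.
- move=> u uF v; rewrite /= /overfill; case: ifP => // /orP[]/set_mem.
    by move/VF; rewrite (negPf uF).
  move=> Vv; apply/eqP; apply: contraNT uF => nz.
  suff : [set` F] u by [].
  by rewrite -FE; right; exists v => //=; rewrite qQ oppr_eq0.
- by move=> u z v; rewrite /= /overfill z; case: ifP.
Qed.

Lemma edge_quiver (Q : LF) x y (F : seq posnat) : x \notin F -> y \notin F -> x != y ->
  exists2 Q' : LF, agree [set` F] Q' Q & LF_arrows Q' x y = LF_arrows Q x y + 2.
Proof.
move=> xF yF xy.
have [Q' Q'E] := add_LF Q (@tournament_quiver 1 [:: x; y])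
  (@tournament_locally_finite 1 [:: x; y]).
exists Q'; last by rewrite Q'E /add_arrows /tournament !inE /= !eqxx orbT (negPf xy).
move=> u v /= uF; rewrite Q'E /add_arrows tournament_zero ?addr0// !inE.
by apply/norP; split; apply: contraTneq uF => ->.
Qed.

(** On a finitely supported quiver nothing happens once the letters of the support have run out. *)
Lemma dense_converges i : infinite_values i = set0 -> dense (converges_LF i).
Proof.
move=> i0; apply/dense_LFP => Q V /(finite_truncation Q)[Q0 [F [a VF zF _]]].
exists Q0 => //; apply/converges_LFP => x.
have [N hN] : exists N, forall k, i k \in F -> True -> (k < N)%N.
  apply: (@finite_letters_bound i F (fun=> True)) => v _ _.
  by apply: contrapT => iv; have : infinite_values i v := iv; rewrite i0.
exists N; elim=> [|n IH]; first by rewrite leqn0 => /eqP ->.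
rewrite leq_eqVlt => /predU1P[-> //|Nn] y; rewrite -(IH Nn) /=.
rewrite mutate_zero_row//; first exact: LF_quiver.
apply/zero_row_upto/zF; apply/negP => /hN/(_ I).
by rewrite ltnNge -ltnS Nn.
Qed.

Lemma not_dense_converges i : infinite_values i !=set0 -> ~ dense (converges_LF i).
Proof.
move=> [x ix] /dense_LFP dC; have [y] := posnat_fresh [:: x].
rewrite inE eq_sym => xy.
have [Q _ e] := @edge_quiver point x y [::] isT isT xy.
have [Q' a] := dC Q [set x] (finite_set1 x).
apply: recurrent_nonzero_diverges ix _ => /(_ y).
by rewrite a// e.
Qed.

(** Some recurrent letter lies outside the support of a truncation; arrows added there make its row
    nonzero without touching the rows in [V]. *)
Lemma dense_diverges_infinite i : infinite_set (infinite_values i) ->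
  dense (diverges_LF i).
Proof.
move=> iI; apply/dense_LFP => Q V /(finite_truncation Q)[Q0 [F [a VF zF _]]].
have [x ix xF] : exists2 x, infinite_values i x & x \notin F.
  apply: contrapT => /forall2NP h; apply: iI.
  apply: (@sub_finite_set _ _ [set` F]) => // x ix /=.
  by have [//|/negP] := h x; rewrite negbK.
have [y] := posnat_fresh (x :: F); rewrite inE negb_or eq_sym => /andP[xy yF].
have [Q' a' e] := edge_quiver Q0 xF yF xy.
exists Q'; first by move=> u v Vu; rewrite a' ?a//=; exact: VF.
apply: recurrent_nonzero_diverges ix _ => /(_ y).
by rewrite e zF.
Qed.

(** Either [Q] has a nonzero recurrent row and diverges itself, or it is truncated with the rows of
    recurrent letters kept at zero and [escaping_diverges] applies. *)
Lemma dense_diverges_escape i : finite_set (infinite_values i) ->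
  infinite_length (reduction (finite_letters i)) -> dense (diverges_LF i).
Proof.
move=> fI il; apply/dense_LFP => Q V fV.
have [[u [iu nz]]|/forallNP zI] :=
    pselect (exists u, infinite_values i u /\ ~ zero_row Q u).
  by exists Q => //; exact: recurrent_nonzero_diverges iu nz.
have fVI : finite_set (V `|` infinite_values i) by rewrite finite_setU.
have [Q0 [F [a VF zF z0]]] := finite_truncation Q fVI.
have IF v : infinite_values i v -> v \in F by move=> iv; apply: VF; right.
have [||||L dL aL] := @escaping_diverges i F Q0.
- by move=> v vF; apply: contrapT => iv; move: vF; rewrite IF.
- by move=> W FW; apply: finite_letters_escape => // v /IF/FW.
- exact: zF.
- move=> u iu; apply: z0; apply: contrapT => nz; exact: (zI u).
exists L => // u v Vu; rewrite aL ?a//; last by apply: VF; left.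
by left.
Qed.

(** Fixing the finitely many recurrent rows at zero gives a neighbourhood of the zero quiver on
    which the sequence converges. *)
Lemma not_dense_diverges i : finite_set (infinite_values i) ->
  finite_length (reduction (finite_letters i)) -> ~ dense (diverges_LF i).
Proof.
move=> fI fl /dense_LFP/(_ point _ fI)[Q a]; apply.
by apply: returning_converges => // u iu v; rewrite a.
Qed.

Theorem theorem1p4 (i : nat -> posnat) :
  let C := converges_LF i in
  let D := diverges_LF i in
  let Sinf := infinite_values i in
  let case_i := C = setT in
  let case_ii := dense C /\ dense D in
  let case_iii := ~ dense C in
  [/\ (* exactly one of the three cases occurs *)
      [\/ [/\ case_i, ~ case_ii & ~ case_iii],
          [/\ ~ case_i, case_ii & ~ case_iii] |
          [/\ ~ case_i, ~ case_ii & case_iii]],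
      (case_i -> D = set0) /\
      (case_i <-> Sinf = set0 /\ finite_length (reduction (posseq_of i))),
      case_ii <-> Sinf = set0 /\ infinite_length (reduction (posseq_of i)),
      case_iii <-> Sinf !=set0 &
      case_iii ->
        (dense D <->
         infinite_set Sinf \/
         infinite_length
           (reduction (restrict_values (~` Sinf) (posseq_of i))))].
Proof.
move=> C D Sinf; rewrite -/(finite_letters i).
have CT : C = setT -> dense C /\ ~ dense D.
  move=> CT; have D0 : D = set0 by rewrite /D /diverges_LF -/C CT setCT.
  split; first by rewrite CT; apply/dense_LFP => Q V _; exists Q.
  by rewrite D0 => /dense_LFP/(_ point set0 (finite_set0 _))[].
have dC : dense C <-> Sinf = set0.
  split; last exact: dense_converges.
  by move=> dC; apply/eqP/negPn/negP => /set0P/not_dense_converges.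
have ndC : ~ dense C <-> Sinf !=set0.
  rewrite dC; split=> [/eqP/set0P//|/set0P/eqP//].
have fin0 : Sinf = set0 -> finite_set Sinf by move=> ->; exact: finite_set0.
have CiffT : C = setT <-> Sinf = set0 /\ finite_length (reduction (posseq_of i)).
  split=> [/CT[/dC S0 nD]|[S0 fl]].
    split => //; apply: contrapT => il; apply: nD.
    by apply: dense_diverges_escape; rewrite ?finite_lettersT//; exact: fin0.
  apply/seteqP; split => // Q _; apply: returning_converges.
    by rewrite -/Sinf S0.
  by rewrite finite_lettersT.
have DD : dense C /\ dense D <->
    Sinf = set0 /\ infinite_length (reduction (posseq_of i)).
  split=> [[/dC S0 dD]|[S0 il]].
    by split => // fl; have /CiffT/CT[] := conj S0 fl.
  split; first exact/dC.
  by apply: dense_diverges_escape; rewrite ?finite_lettersT//; exact: fin0.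
split => //.
- have [S0|nS0] := pselect (Sinf = set0); last first.
    constructor 3; split; first by move=> /CiffT[].
      by move=> /DD[].
    by move/dC.
  have [fl|il] := pselect (finite_length (reduction (posseq_of i))).
    constructor 1; split; [exact/CiffT|by move=> /DD[_]|by rewrite dC].
  constructor 2; split; [by move=> /CiffT[_]|exact/DD|by rewrite dC].
- by split => // CT'; rewrite /D /diverges_LF -/C CT' setCT.
move=> _; split=> [dD|[]].
- have [fS|iS] := pselect (finite_set Sinf); last by left.
  by right => fl; exact: not_dense_diverges fS fl dD.
- exact: dense_diverges_infinite.
have [fS|iS _] := pselect (finite_set Sinf); last exact: dense_diverges_infinite.
exact: dense_diverges_escape.
Qed.
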